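(* If the wide network limit $Q_t$ converges in $\mathcal{H}^1$, as $t\to\infty$, to a fixed point $Q$ of its dynamics (i.e. $Q\in\mathcal{H}^2$ with $\mathcal{B}\mathcal{L}(Q)=0$), then $Q$ is a solution to the PDE $\mathcal{L}u=0$ in $\Omega$, $u=f$ on $\partial\Omega$.
   Context: **Domain and spaces.** $\Omega\subset\mathbb{R}^n$ is a bounded open set whose boundary is $C^{3,\kappa}$ for some $\kappa\in(0,1)$. $\mu$ is a measure on $\Omega$ with a continuous density with respect to Lebesgue measure, bounded away from $0$ and $\infty$. All $L^2$ norms and inner products and all Sobolev spaces on $\Omega$ are taken with respect to $\mu$: $\mathcal{H}^p=\{g\in L^2(\Omega,\mu):\|g\|_{\mathcal{H}^p}=\sum_{|\alpha|\le p}\|D^\alpha g\|_{L^2}<\infty\}$ (weak derivatives). $C^k_b$ denotes functions with bounded continuous derivatives up to order $k$ (order $0$ included). The auxiliary function $\eta\in C^3_b(\mathbb{R}^n)$ satisfies $0<\eta<1$ in $\Omega$, $\eta=0$ on $\partial\Omega$, and $\langle\nabla\eta(x),\mathbf{n}_x\rangle\ne0$ for $x\in\partial\Omega$, with $\mathbf{n}_x$ the outward unit normal. **PDE.** The PDE is $\mathcal{L}u=0$ in $\Omega$, $u=f$ on $\partial\Omega$; solutions are strong Sobolev solutions $u\in\mathcal{H}^2$, the boundary condition being understood in the trace sense. $f$ is identified with a given extension $f\in\mathcal{H}^2$ whose boundary trace is the boundary datum. $\mathcal{L}$ is a (nonlinear) second-order differential operator for which there is a constant $C$ with, for all $f_1,f_2\in\mathcal{H}^2\cap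 C^2$ and $x\in\Omega$, $$|\mathcal{L}f_1(x)-\mathcal{L}f_2(x)|\le C\Big[|f_1(x)-f_2(x)|+\sum_{i=1}^n|\partial_{x_i}f_1(x)-\partial_{x_i}f_2(x)|+\tfrac12\sum_{i,j=1}^n|\partial^2_{x_ix_j}f_1(x)-\partial^2_{x_ix_j}f_2(x)|\Big],$$ and $\mathcal{L}0\in L^2$; thus $\mathcal{L}$ is a Lipschitz operator $\mathcal{H}^2\to L^2$. **Kernel.** $\sigma\in C^4_b(\mathbb{R})$ is non-constant. $c,b$ (real) and $w$ ($\mathbb{R}^n$-valued) are independent random variables with $|c|<K_0$, $\mathbb{E}[c]=0$; the law of $(w,b)$ charges every nonempty open subset of $\mathbb{R}^{n+1}$; $\mathbb{E}[|w_k|^3]<\infty$ for every $k$, $\mathbb{E}[|b|]<\infty$. Set $$A(x,y)=\mathbb{E}_{c,w,b}\big[\sigma(w\cdot x+b)\sigma(w\cdot y+b)+c^2\sigma'(w\cdot x+b)\sigma'(w\cdot y+b)(x\cdot y+1)\big],$$ $B(x,y)=\eta(x)\eta(y)A(x,y)$, and $(\mathcal{B}v)(y)=\int_\Omega B(x,y)v(x)\,d\mu(x)$. **Wide network limit.** With $\alpha>0$ constant, $Q_t$ is the $\mathcal{H}^2$-valued solution of $\frac{dQ_t}{dt}=\alpha\mathcal{B}\mathcal{L}(Q_t)$, $Q_0=f$. (It is the large-width limit of the neural networks $N^{-\beta}\eta(x)\sum_{i=1}^Nc^i\sigma(w^i\cdot x+b^i)+f(x)$ under training, and has boundary trace $f$.)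 *)

(* Defs.v *)
From HB Require Import structures.
From mathcomp Require Import all_boot all_order all_algebra.
From mathcomp Require Import all_classical all_reals all_analysis.
From mathcomp Require Import measurable_realfun.
Set Implicit Arguments. Unset Strict Implicit. Unset Printing Implicit Defensive.
Import Order.TTheory GRing.Theory Num.Theory.
Import numFieldNormedType.Exports.
Local Open Scope classical_set_scope.
Local Open Scope ring_scope.

(* Points of R^n are row vectors x : 'rV[R]_n, with coordinates x 0 i. *)

Fact rV_display : measure_display. Proof. exact: default_measure_display. Qed.

Section borel.
Context (R : realType) (n : nat).
HB.instance Definition _ := @isMeasurable.Build rV_display 'rV[R]_n
  <<s @open 'rV[R]_n >> (@sigma_algebra0 _ setT _)
  (fun A mA => eq_ind _ _ (sigma_algebraCD mA) _ (setTD A))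
  (@sigma_algebra_bigcup _ setT _).

Lemma open_measurable_rV (A : set 'rV[R]_n) : open A -> measurable A.
Proof. exact: sub_gen_smallest. Qed.

Lemma continuous_measurable_rV (f : 'rV[R]_n -> R) :
  continuous f -> measurable_fun setT f.
Proof.
move=> cf; refine (@measurability _ _ 'rV[R]_n R _ _ _ (RGenOInfty.measurableE R) _).
move=> _ [_ [a ->] <-]; rewrite setTI; apply: open_measurable_rV.
by apply: open_comp => [x _|]; [exact: cf|exact: interval_open].
Qed.

Lemma measurable_coord_rV i : measurable_fun setT (fun x : 'rV[R]_n => x 0 i).
Proof. by apply: continuous_measurable_rV; exact: coord_continuous. Qed.

Lemma measurable_fun_rV d (T : measurableType d) (f : T -> 'rV[R]_n) :
  (forall i, measurable_fun setT (fun t => f t 0 i)) -> measurable_fun setT f.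
Proof.
move=> mf; apply: (measurability (@open 'rV[R]_n)) => // _ [U oU <-].
rewrite setTI.
pose box (p : 'rV[rat]_n * rat) : set 'rV[R]_n :=
  [set x | forall i, `|ratr (p.1 0 i) - x 0 i| < ratr p.2].
have -> : U = \bigcup_(p in [set p | box p `<=` U]) box p.
  apply/seteqP; split=> [x Ux|x [p /= pU px]]; last exact: pU.
  have /nbhs_ballP[e /= e0 eU] : nbhs x U by exact: open_nbhs_nbhs.
  have e20 : 0 < e / 2 by rewrite divr_gt0.
  have [r /andP[r0 re]] : exists r : rat, 0 < (ratr r : R) < e / 2.
    have [r] := rat_in_itvoo e20.
    by rewrite in_itv /= => re; exists r.
  have /choice[q qx] : forall i : 'I_n,
      exists q : rat, `|ratr q - x 0 i| < (ratr r : R).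
    move=> i; have /rat_in_itvoo[q] : x 0 i < x 0 i + ratr r by rewrite ltrDl.
    rewrite in_itv /= => /andP[q1 q2]; exists q.
    by rewrite gtr0_norm ?subr_gt0// ltrBlDl.
  exists (\row_i q i, r) => /=; last by move=> i /=; rewrite mxE.
  move=> y /= yr; apply: eU; split => // i j; rewrite ord1 /ball /=.
  have := yr j; rewrite mxE => yj.
  rewrite (le_lt_trans (ler_distD (ratr (q j)) _ _))// (splitr e) ltrD//.
    by rewrite distrC (lt_trans (qx j)).
  exact: lt_trans re.
rewrite preimage_bigcup bigcup_mkcond.
apply: countable_bigcupT_measurable => // p; case: ifPn => // _.
rewrite -[X in measurable X]setCK; apply: measurableC.
have -> : ~` (f @^-1` box p) =
    \bigcup_i (fun t => `|ratr (p.1 0 i) - f t 0 i| : R) @^-1` `[ratr p.2, +oo[.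
  rewrite predeqE => t; split=> [/existsNP[i /negP]|[i _]] /=.
    by rewrite -leNgt => h; exists i => //=; rewrite in_itv /= h.
  by rewrite in_itv /= andbT => + h; have := h i; rewrite ltNge => /negP.
apply: countable_bigcupT_measurable => // i; rewrite -[X in measurable X]setTI.
have mi : measurable_fun setT (fun t => `|ratr (p.1 0 i) - f t 0 i| : R).
  by apply: measurableT_comp => //; apply: measurable_funB.
exact: mi.
Qed.
End borel.

Section lebesgue_rV.
Context (R : realType).

Definition cons_rV n (p : measurableTypeR R * 'rV[R]_n) : 'rV[R]_n.+1 :=
  \row_i oapp (p.2 0) p.1 (unlift ord0 i).

Lemma measurable_cons_rV n : measurable_fun setT (@cons_rV n).
Proof.
apply: measurable_fun_rV => i.
have -> : (fun p : measurableTypeR R * 'rV[R]_n => cons_rV p 0 i) =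
    (fun p => oapp (p.2 0) p.1 (unlift ord0 i)).
  by apply/funext => p; rewrite mxE.
case: (unlift ord0 i) => [j|] /=; last exact: measurable_fst.
exact: (measurableT_comp (measurable_coord_rV j) measurable_snd).
Qed.

Definition uncons_rV n (x : 'rV[R]_n.+1) : measurableTypeR R * 'rV[R]_n :=
  (x 0 ord0, \row_j x 0 (lift ord0 j)).

Lemma cons_rVK n : cancel (@cons_rV n) (@uncons_rV n).
Proof.
move=> [a x]; rewrite /uncons_rV /cons_rV mxE unlift_none /=; congr pair.
by apply/rowP => j; rewrite !mxE liftK.
Qed.

Lemma measurable_uncons_rV n : measurable_fun setT (@uncons_rV n).
Proof.
apply: measurable_fun_pair; first exact: measurable_coord_rV.
apply: measurable_fun_rV => j.
have -> : (fun x : 'rV[R]_n.+1 => (\row_j x 0 (lift ord0 j)) 0 j) =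
    (fun x => x 0 (lift ord0 j)) by apply/funext => x; rewrite mxE.
exact: measurable_coord_rV.
Qed.

Section step.
Local Open Scope ereal_scope.
Context n (m : {sigma_finite_measure set 'rV[R]_n -> \bar R}).

Definition lebesgue_cons : set 'rV[R]_n.+1 -> \bar R :=
  pushforward (lebesgue_measure \x m) (@cons_rV n).

Let mpre A : measurable A -> measurable (@cons_rV n @^-1` A).
Proof.
by move=> mA; rewrite -[X in measurable X]setTI; exact: measurable_cons_rV.
Qed.

Let lebesgue_cons0 : lebesgue_cons set0 = 0.
Proof. by rewrite /lebesgue_cons /pushforward preimage_set0 measure0. Qed.

Let lebesgue_cons_ge0 A : 0 <= lebesgue_cons A.
Proof. exact: (measure_ge0 (lebesgue_measure \x m)). Qed.

Let lebesgue_cons_sigma_additive : semi_sigma_additive lebesgue_cons.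
Proof.
move=> F mF tF mUF; rewrite /lebesgue_cons /pushforward preimage_bigcup.
apply: measure_semi_sigma_additive => [i||]; first exact: mpre.
  apply/trivIsetP => /= i j _ _ ij; rewrite -preimage_setI.
  by move/trivIsetP : tF => /(_ _ _ _ _ ij) ->//; rewrite preimage_set0.
by rewrite -preimage_bigcup; exact: mpre.
Qed.

HB.instance Definition _ := isMeasure.Build _ _ _ lebesgue_cons
  lebesgue_cons0 lebesgue_cons_ge0 lebesgue_cons_sigma_additive.

Let lebesgue_cons_sigma_finite : sigma_finite setT lebesgue_cons.
Proof.
have /sigma_finiteP[F [TF ndF Foo]] := sigma_finiteT (@lebesgue_measure R).
have /sigma_finiteP[G [TG ndG Goo]] := sigma_finiteT m.
exists (fun k => @uncons_rV n @^-1` (F k `*` G k)).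
  rewrite -preimage_bigcup predeqE => x; split=> // _ /=.
  have [i _ Fi] : (\bigcup_i F i) (uncons_rV x).1 by rewrite -TF.
  have [j _ Gj] : (\bigcup_i G i) (uncons_rV x).2 by rewrite -TG.
  exists (maxn i j) => //; split.
  - by move: Fi; exact/subsetPset/ndF/leq_maxl.
  - by move: Gj; exact/subsetPset/ndG/leq_maxr.
move=> k; have [mF Fk] := Foo k; have [mG Gk] := Goo k; split.
  rewrite -[X in measurable X]setTI; apply: measurable_uncons_rV => //.
  exact: measurableX.
rewrite /lebesgue_cons /pushforward -comp_preimage.
rewrite (_ : _ \o _ = idfun); last by apply/funext => p; exact: cons_rVK.
rewrite preimage_id product_measure1E// lte_mul_pinfty// ge0_fin_numE//.
Qed.

HB.instance Definition _ := Measure_isSigmaFinite.Build _ _ _ lebesgue_cons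
  lebesgue_cons_sigma_finite.

End step.

Fixpoint lebesgue_rV n : {sigma_finite_measure set 'rV[R]_n -> \bar R} :=
  if n is n'.+1 then lebesgue_cons (lebesgue_rV n') else \d_ (0 : 'rV[R]_0).

End lebesgue_rV.
Arguments lebesgue_rV {R} n.

Section euclidean.
Context (R : realType) (n : nat).
Implicit Types x y : 'rV[R]_n.

Definition dotv x y : R := \sum_i x 0 i * y 0 i.

(* The norm that `|x| denotes on 'rV[R]_n is the sup norm, hence this one. *)
Definition enorm x : R := Num.sqrt (dotv x x).

Definition diam (A : set 'rV[R]_n) : \bar R :=
  ereal_sup [set (enorm (p.1 - p.2))%:E | p in A `*` A].

End euclidean.

(* d-dimensional Hausdorff measure on R^n, without the normalising constant
   (volume of the d-dimensional ball of diameter 1).  Covers are taken by Borel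
   sets, which does not change the value since a set and its closure have the
   same diameter. *)
Section hausdorff.
Local Open Scope ereal_scope.
Context (R : realType) (n d : nat).

Definition hausdorff_gauge (delta : R) (A : set 'rV[R]_n) : \bar R :=
  if A == set0 then 0 else if diam A <= delta%:E then diam A ^+ d else +oo.

Definition hausdorff (A : set 'rV[R]_n) : \bar R :=
  ereal_sup [set mu_ext (hausdorff_gauge delta) A
            | delta in [set delta : R | (0 < delta)%R]].

Let gauge0 delta : hausdorff_gauge delta set0 = 0.
Proof. by rewrite /hausdorff_gauge eqxx. Qed.

Let gauge_ge0 delta A : 0 <= hausdorff_gauge delta A.
Proof.
rewrite /hausdorff_gauge; case: ifPn => // /set0P[x Ax]; case: ifPn => // _.
apply: expe_ge0; apply: le_ereal_sup_tmp; exists (enorm (x - x))%:E.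
  by exists (x, x).
by rewrite lee_fin sqrtr_ge0.
Qed.

Let le_ext delta A : (0 < delta)%R ->
  mu_ext (hausdorff_gauge delta) A <= hausdorff A.
Proof. by move=> d0; apply: ereal_sup_ubound; exists delta. Qed.

Let hausdorff_ge0 A : 0 <= hausdorff A.
Proof. by apply: le_trans (le_ext A ltr01); exact: mu_ext_ge0. Qed.

Let hausdorff0 : hausdorff set0 = 0.
Proof.
apply/eqP; rewrite eq_le hausdorff_ge0 andbT.
by apply: ge_ereal_sup => _ [e e0 <-]; rewrite mu_ext0.
Qed.

Let le_hausdorff : {homo hausdorff : A B / A `<=` B >-> A <= B}.
Proof.
move=> A B AB; apply: ge_ereal_sup => _ [e e0 <-].
exact: le_trans (le_mu_ext _ AB) (le_ext _ e0).
Qed.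

Let hausdorff_sigma_subadditive : sigma_subadditive hausdorff.
Proof.
move=> F; apply: ge_ereal_sup => _ [e e0 <-].
apply: le_trans (mu_ext_sigma_subadditive (gauge_ge0 e) F) _.
by apply: lee_nneseries => [i _ _|i _]; [exact: mu_ext_ge0|exact: le_ext].
Qed.

HB.instance Definition _ := isOuterMeasure.Build R 'rV[R]_n hausdorff
  hausdorff0 hausdorff_ge0 le_hausdorff hausdorff_sigma_subadditive.

End hausdorff.

(* Surface measure on hypersurfaces of R^n: (n-1)-dimensional Hausdorff measure
   (up to normalisation, which does not affect L^2), on the sigma-algebra of
   Caratheodory-measurable sets, which contains the Borel sets. *)
Definition surface_outer_measure (R : realType) (n : nat) :
  {outer_measure set 'rV[R]_n -> \bar R} := @hausdorff R n n.-1.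

Definition surface_measure (R : realType) (n : nat) :
    {measure set (caratheodory_type (surface_outer_measure R n)) -> \bar R} :=
  OuterMeasure.sort (surface_outer_measure R n).

Definition L2norm d (T : measurableType d) (R : realType)
    (mu : {measure set T -> \bar R}) (D : set T) (g : T -> R) : \bar R :=
  Lnorm mu 2%:E (fun x => (g x * \1_D x)%:E).

Definition inL2 d (T : measurableType d) (R : realType)
    (mu : {measure set T -> \bar R}) (D : set T) (g : T -> R) :=
  measurable_fun D g /\ (L2norm mu D g < +oo)%E.

Section classical_derivatives.
Context (R : realType) (n : nat).
Implicit Types (U : set 'rV[R]_n) (g : 'rV[R]_n -> R).

Definition partial (i : 'I_n) g : 'rV[R]_n -> R :=
  fun x => 'D_(delta_mx 0 i) g x.

Definition partials (s : seq 'I_n) g : 'rV[R]_n -> R := foldr partial g s.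

(* Only meant for open U: continuity at x is continuity in R^n. *)
Definition Ck U (k : nat) g := forall s : seq 'I_n, (size s <= k)%N ->
  (forall x, U x -> {for x, continuous (partials s g)}) /\
  ((size s < k)%N -> forall i x, U x ->
    derivable (partials s g) x (delta_mx 0 i)).

Definition Ckb (k : nat) g := Ck setT k g /\
  forall s : seq 'I_n, (size s <= k)%N ->
    exists M, forall x, `|partials s g x| <= M.

Definition Ck_holder (k : nat) (kappa : R) g := Ck setT k g /\
  forall s : seq 'I_n, size s = k ->
    exists M, forall x y,
      `|partials s g x - partials s g y| <= M * enorm (x - y) `^ kappa.

Definition grad g (x : 'rV[R]_n) : 'rV[R]_n := \row_i partial i g x.

Definition test_function (Omega : set 'rV[R]_n) (phi : 'rV[R]_n -> R) :=
  (forall k, Ck setT k phi) /\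
  exists2 K, compact K /\ K `<=` Omega & forall x, ~ K x -> phi x = 0.

End classical_derivatives.

Section domain.
Context (R : realType) (n : nat) (Omega : set 'rV[R]_n).

Definition boundary : set 'rV[R]_n := closure Omega `\` interior Omega.

(* Near each boundary point, in coordinates y = x *m O obtained by an orthogonal
   change of basis, Omega is the strict epigraph, in the direction of some
   coordinate j, of a C^(k,kappa) function of the n - 1 other coordinates. *)
Definition holder_boundary (k : nat) (kappa : R) :=
  forall x0, boundary x0 ->
  exists (r : R) (O : 'M[R]_n) (j : 'I_n) (gamma : 'rV[R]_n.-1 -> R),
    [/\ 0 < r, O *m O^T = 1%:M, Ck_holder k kappa gamma &
        forall x, ball x0 r x ->
          (Omega x <-> gamma (col' j (x *m O)) < (x *m O) 0 j)].

Definition tangent_vector (x v : 'rV[R]_n) :=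
  exists c : R -> 'rV[R]_n,
    [/\ c 0 = x, is_derive (0 : R) (1 : R) c v &
        \forall s \near (0 : R), boundary (c s)].

Definition outward_unit_normal (x nu : 'rV[R]_n) :=
  [/\ enorm nu = 1, forall v, tangent_vector x v -> dotv v nu = 0 &
      \forall s \near (0 : R)^'+, ~ Omega (x + s *: nu)].

End domain.

(* mu has a continuous density with respect to Lebesgue measure on Omega, bounded
   away from 0 and infinity; it does not charge the complement of Omega. *)
Definition continuous_density (R : realType) (n : nat) (Omega : set 'rV[R]_n)
    (mu : {measure set 'rV[R]_n -> \bar R}) :=
  exists rho : 'rV[R]_n -> R,
    [/\ forall x, Omega x -> {for x, continuous rho},
        exists m M : R, 0 < m /\ forall x, Omega x -> m <= rho x <= M &
        forall A, measurable A ->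
          mu A = (\int[lebesgue_rV n]_(x in A `&` Omega) (rho x)%:E)%E].

(* Elements of the function spaces are represented by functions on R^n of which
   only the values in Omega matter. *)
Section sobolev.
Context (R : realType) (n : nat) (Omega : set 'rV[R]_n)
        (mu : {measure set 'rV[R]_n -> \bar R}).
Implicit Types u v : 'rV[R]_n -> R.

Definition locally_integrable_on u := measurable_fun Omega u /\
  forall K, compact K -> K `<=` Omega ->
    (lebesgue_rV n).-integrable K (EFin \o u).

(* v is the weak derivative in Omega of u along the indices listed in s. *)
Definition weak_derivative (s : seq 'I_n) u v :=
  [/\ locally_integrable_on u, locally_integrable_on v &
      forall phi, test_function Omega phi ->
        \int[lebesgue_rV n]_(x in Omega) (u x * partials s phi x) =
        (-1) ^+ size s * \int[lebesgue_rV n]_(x in Omega) (v x * phi x)].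

Definition multi_index p (a : {ffun 'I_n -> 'I_p.+1}) : seq 'I_n :=
  flatten [seq nseq (a i) i | i <- enum 'I_n].

(* The weak derivative, when it exists, is unique up to null sets, so that the
   infimum is the norm of the weak derivative, and +oo if there is none. *)
Definition sobnorm (p : nat) u : \bar R :=
  (\sum_(a : {ffun 'I_n -> 'I_p.+1} | (\sum_i a i <= p)%N)
    ereal_inf [set L2norm mu Omega v
              | v in weak_derivative (multi_index a) u])%E.

Definition sobolev (p : nat) u :=
  inL2 mu Omega u /\ (sobnorm p u < +oo)%E.

(* g in L^2 of the boundary is the trace of u in H^1: the trace operator is the
   extension by continuity, from H^1 to L^2 of the boundary, of the restriction
   to the boundary of functions that are C^1 up to the boundary. *)
Definition has_trace u (g : 'rV[R]_n -> R) :=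
  inL2 (surface_measure R n) (boundary Omega) g /\
  exists v : nat -> 'rV[R]_n -> R,
    [/\ forall k, Ck setT 1 (v k),
        sobnorm 1 (fun x => v k x - u x) @[k --> \oo] --> 0%E &
        L2norm (surface_measure R n) (boundary Omega) (fun x => v k x - g x)
          @[k --> \oo] --> 0%E].

(* L, given pointwise on functions of H^2 that are C^2, is Lipschitz in the
   2-jet (in particular L v x only depends on the 2-jet of v at x), and is
   extended to a Lipschitz operator from H^2 to L^2. *)
Definition lipschitz_operator (L : ('rV[R]_n -> R) -> 'rV[R]_n -> R) :=
  [/\ exists C : R, forall u v,
        sobolev 2 u -> sobolev 2 v -> Ck Omega 2 u -> Ck Omega 2 v ->
        forall x, Omega x ->
        `|L u x - L v x| <=
          C * (`|u x - v x| + \sum_i `|partial i u x - partial i v x|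
               + 2^-1 * \sum_i \sum_j `|partial i (partial j u) x
                                        - partial i (partial j v) x|),
      inL2 mu Omega (L (cst 0)),
      forall u, sobolev 2 u -> inL2 mu Omega (L u) &
      exists C : R, forall u v, sobolev 2 u -> sobolev 2 v ->
        (L2norm mu Omega (fun x => (L u x - L v x)%R)
         <= C%:E * sobnorm 2 (fun x => (u x - v x)%R))%E].

Definition strong_solution (L : ('rV[R]_n -> R) -> 'rV[R]_n -> R)
    (g u : 'rV[R]_n -> R) :=
  [/\ sobolev 2 u, ae_eq mu Omega (L u) (cst 0) & has_trace u g].

Definition admissible_eta (eta : 'rV[R]_n -> R) :=
  [/\ Ckb 3 eta,
      forall x, Omega x -> 0 < eta x < 1,
      forall x, boundary Omega x -> eta x = 0 &
      forall x nu, boundary Omega x -> outward_unit_normal Omega x nu ->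
        dotv (grad eta x) nu != 0].

End sobolev.

Definition admissible_sigma (R : realType) (sigma : R -> R) :=
  (forall k, (k <= 4)%N ->
    [/\ continuous (derive1n k sigma),
        (k < 4)%N -> forall x, derivable (derive1n k sigma) x 1 &
        exists M, forall x, `|derive1n k sigma x| <= M]) /\
  exists x y, sigma x != sigma y.

Section kernel.
Context d (T : measurableType d) (R : realType) (P : probability T R) (n : nat).
Variables (c b : {RV P >-> R}) (w : {RV P >-> 'rV[R]_n}).

Definition independent3 := forall (A B : set R) (C : set 'rV[R]_n),
  measurable A -> measurable B -> measurable C ->
  P (c @^-1` A `&` b @^-1` B `&` w @^-1` C)
  = (P (c @^-1` A) * P (b @^-1` B) * P (w @^-1` C))%E.

Definition admissible_parameters (K0 : R) :=
  [/\ independent3,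
      {ae P, forall t, `|c t| < K0} /\ 'E_P[c]%E = 0%E,
      forall U : set ('rV[R]_n * R), open U -> U !=set0 ->
        (0 < P [set t | U (w t, b t)])%E,
      forall k, ('E_P[fun t => (`|w t 0 k| ^+ 3)%R] < +oo)%E &
      ('E_P[fun t => `|b t|%R] < +oo)%E].

Variables (sigma : R -> R) (eta : 'rV[R]_n -> R).

Definition kerA (x y : 'rV[R]_n) : R :=
  fine 'E_P[fun t =>
    (sigma (dotv (w t) x + b t) * sigma (dotv (w t) y + b t)
    + c t ^+ 2 * derive1 sigma (dotv (w t) x + b t)
      * derive1 sigma (dotv (w t) y + b t) * (dotv x y + 1))%R]%E.

Definition kerB (x y : 'rV[R]_n) : R := eta x * eta y * kerA x y.

Definition opB (Omega : set 'rV[R]_n) (mu : {measure set 'rV[R]_n -> \bar R})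
    (v : 'rV[R]_n -> R) : 'rV[R]_n -> R :=
  fun y => \int[mu]_(x in Omega) (kerB x y * v x).

End kernel.

(* Q is an H^2-valued solution of dQ/dt = alpha B (L Q) for t >= 0, Q_0 = f; at
   t = 0 the derivative is one-sided. *)
Definition wide_network_limit (R : realType) (n : nat) (Omega : set 'rV[R]_n)
    (mu : {measure set 'rV[R]_n -> \bar R})
    (B L : ('rV[R]_n -> R) -> 'rV[R]_n -> R) (alpha : R) (f : 'rV[R]_n -> R)
    (Q : R -> 'rV[R]_n -> R) :=
  [/\ forall t, 0 <= t -> sobolev Omega mu 2 (Q t),
      ae_eq mu Omega (Q 0) f &
      forall t, 0 <= t ->
        sobnorm Omega mu 2
          (fun x => h^-1 * (Q (t + h) x - Q t x) - alpha * B (L (Q t)) x)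
          @[h --> within [set h | 0 <= t + h] (0 : R)^'] --> 0%E].

(* Main.v *)
(** Write [B v (y) = eta y * sum_k E[S_k(v) phi_k(y)]], where the features phi_k are
    [sigma (w.x + b)], [c sigma' (w.x + b)] and [c sigma' (w.x + b) x_j], and
    [S_k(v)] is the integral of [eta v phi_k].

    Boundary condition: [B v] is C^1 and vanishes on the boundary with [eta], so the
    H^1-distance from [Q_t - f] to the C^1 functions vanishing on the boundary has
    zero derivative in t.  It starts at 0, hence stays 0, and the trace of f is
    inherited by [Q_t] and by its H^1-limit.

    Equation: if [B v = 0], then [0 = <v, B v> = sum_k E[S_k(v)^2]], so that the
    integral of [eta v sigma (w.x + b)] vanishes for almost every, hence by
    continuity and full support for every, (w, b).  Differentiating in [w_i] and
    then in b shows that [x_i eta v] is annihilated by every difference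
    [sigma (. + e) - sigma]; one of these is nonconstant since sigma is bounded and
    nonconstant.  By induction all moments of [eta v] vanish.  Functions with
    vanishing moments are stable under multiplication by polynomials, hence by their
    bounded pointwise limits, hence by indicators of half-spaces and of all Borel
    sets; so [eta v = 0]. *)

Require Import Defs.
From HB Require Import structures.
From mathcomp Require Import all_boot all_order all_algebra.
From mathcomp Require Import all_classical all_reals all_analysis.
From mathcomp Require Import ring lra measurable_realfun.
Set Implicit Arguments. Unset Strict Implicit. Unset Printing Implicit Defensive.
Import Order.TTheory GRing.Theory Num.Theory.
Import numFieldNormedType.Exports.
Local Open Scope classical_set_scope.
Local Open Scope ring_scope.

(** * Differentiation under the integral sign *)

(** The obstacle in the moment argument is loss of derivatives: one differentiation per coordinate
    would require [sigma] to be smooth to every order. The derivative is therefore used only to see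
    that an integral does not depend on b; the next ridge function is a difference of the previous
    one, not its derivative. It stays bounded with a bounded Lipschitz derivative, so the induction
    can have any length, and boundedness is also what makes some difference nonconstant at each
    stage. For the boundary condition, the scalar distance replaces the formula Q_t = f + alpha
    int_0^t B L Q_s ds, and so avoids integrals with values in a Sobolev space. Only increments of Q
    at a single time are ever compared with B L Q_t. *)

Section bounded_C11.
Context (R : realType).
Implicit Types (G g : R -> R) (M : R).

(** The class C^{1,1} with one constant for all bounds. It gives a second-order Taylor estimate
    without a second derivative, and it is stable under differences [G(. + e) - G], at the price of
    doubling [M]. *)
Definition C11 M G g :=
  [/\ forall x, `|G x| <= M, forall x : R, is_derive x (1 : R) G (g x),
      forall x, `|g x| <= M & forall x y, `|g x - g y| <= M * `|x - y|].

Lemma mean_value G g (x y : R) : (forall z : R, is_derive z (1 : R) G (g z)) ->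
  exists2 z, `|z - x| <= `|y - x| & G y - G x = g z * (y - x).
Proof.
move=> dG.
have cG a b : {within `[a, b], continuous G}.
  apply/continuous_subspaceT=> r.
  exact/differentiable_continuous/derivable1_diffP.
have [xy|/ltW yx] := leP x y.
  have [z zxy e] := MVT_segment xy (fun z _ => dG z) (cG _ _).
  exists z => //; move: zxy; rewrite in_itv /= => /andP[xz zy].
  by rewrite !ger0_norm ?subr_ge0// lerB.
have [z zxy e] := MVT_segment yx (fun z _ => dG z) (cG _ _).
exists z; last by rewrite -opprB e; ring.
move: zxy; rewrite in_itv /= => /andP[yz zx].
by rewrite distrC [leRHS]distrC !ger0_norm ?subr_ge0// lerB.
Qed.

Lemma bounded_derive_lipschitz M G g :
  (forall z : R, is_derive z (1 : R) G (g z)) -> (forall z, `|g z| <= M) ->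
  forall x y, `|G x - G y| <= M * `|x - y|.
Proof.
move=> dG gM x y; have [z _ ->] := mean_value y x dG.
by rewrite normrM ler_wpM2r.
Qed.

Lemma C11_ge0 M G g : C11 M G g -> 0 <= M.
Proof. by move=> [+ _ _ _] => /(_ 0); apply: le_trans. Qed.

Lemma C11_lipschitz M G g : C11 M G g ->
  forall x y, `|G x - G y| <= M * `|x - y|.
Proof. by move=> [_ + + _]; exact: bounded_derive_lipschitz. Qed.

(** By the mean value theorem the increment is [g z * v] with z within [|v|] of u, and replacing
    [g z] by [g u] costs at most [M * |v|]. *)
Lemma C11_taylor M G g : C11 M G g ->
  forall u v, `|G (u + v) - G u - v * g u| <= M * v ^+ 2.
Proof.
move=> MG u v; have M0 := C11_ge0 MG; case: MG => _ dG _ lg.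
have [z + ->] := mean_value u (u + v) dG.
rewrite [u + v - u]addrAC subrr add0r => zu.
rewrite [v * _]mulrC -mulrBl normrM (le_trans (ler_wpM2r _ (lg _ _)))//.
rewrite -mulrA ler_wpM2l// -[v ^+ 2]real_normK ?num_real// expr2.
by rewrite ler_wpM2r//.
Qed.

Lemma lipschitz_continuous M G :
  (forall x y, `|G x - G y| <= M * `|x - y|) -> continuous G.
Proof.
move=> lG x; apply/cvgrPdist_lt => e e0; near=> y.
rewrite (le_lt_trans (lG _ _))//.
have M1 : 0 < `|M| + 1 by rewrite ltr_wpDl.
apply: (@le_lt_trans _ _ ((`|M| + 1) * `|x - y|)).
  by rewrite ler_wpM2r// ler_wpDr// ler_norm.
rewrite mulrC -ltr_pdivlMr//; near: y.
by apply/nbhs_ballP; exists (e / (`|M| + 1)) => //=; rewrite divr_gt0.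
Unshelve. all: by end_near. Qed.

Lemma C11_measurable M G g : C11 M G g -> measurable_fun setT G.
Proof.
by move=> /C11_lipschitz/lipschitz_continuous; exact: continuous_measurable_fun.
Qed.

Lemma C11_derive_measurable M G g : C11 M G g -> measurable_fun setT g.
Proof.
by move=> [_ _ _] /lipschitz_continuous; exact: continuous_measurable_fun.
Qed.

End bounded_C11.

Section integrability.
Context d (T : measurableType d) (R : realType) (m : {measure set T -> \bar R}).
Implicit Types Z F u a : T -> R.

Lemma dominated_integrable_fun (Z F : T -> R) : measurable_fun setT F ->
  m.-integrable setT (EFin \o Z) -> (forall t, `|F t| <= `|Z t|) ->
  m.-integrable setT (EFin \o F).
Proof.
move=> mF iZ FZ; apply: (le_integrable measurableT _ _ iZ).
  exact/measurable_EFinP.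
by move=> t _; rewrite /= lee_fin.
Qed.

Lemma integrable_scale (k : R) Z : m.-integrable setT (EFin \o Z) ->
  m.-integrable setT (EFin \o (fun t => k * Z t)).
Proof.
move=> iZ.
have -> : EFin \o (fun t => k * Z t) = (fun t => (k%:E * (EFin \o Z) t)%E).
  by apply/funext => t /=; rewrite EFinM.
exact: integrableZl.
Qed.

Lemma integrable_add Z F : m.-integrable setT (EFin \o Z) ->
  m.-integrable setT (EFin \o F) ->
  m.-integrable setT (EFin \o (fun t => Z t + F t)).
Proof. by move=> iZ iF; exact: (integrableD measurableT iZ iF). Qed.

Lemma integrable_sub Z F : m.-integrable setT (EFin \o Z) ->
  m.-integrable setT (EFin \o F) ->
  m.-integrable setT (EFin \o (fun t => Z t - F t)).
Proof. by move=> iZ iF; exact: (integrableB measurableT iZ iF). Qed.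

Lemma integrable_measurable Z : m.-integrable setT (EFin \o Z) ->
  measurable_fun setT Z.
Proof. by move=> /measurable_int/measurable_EFinP. Qed.

Lemma integrable_bounded_mul (K : R) Z F : measurable_fun setT F ->
  m.-integrable setT (EFin \o Z) -> (forall t, `|Z t * F t| <= K * `|Z t|) ->
  m.-integrable setT (EFin \o (fun t => Z t * F t)).
Proof.
move=> mF iZ ZF.
apply: (@dominated_integrable_fun (fun t => K * Z t)).
- by apply: measurable_funM => //; exact: integrable_measurable.
- exact: integrable_scale.
- move=> t; rewrite (le_trans (ZF t))// normrM ler_wpM2r//; exact: ler_norm.
Qed.

Lemma le_norm_Rintegral (Z F : T -> R) : measurable_fun setT F ->
  m.-integrable setT (EFin \o Z) -> (forall t, `|F t| <= Z t) ->
  `|\int[m]_t F t| <= \int[m]_t Z t.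
Proof.
move=> mF iZ FZ.
have iF : m.-integrable setT (EFin \o F).
  apply: (dominated_integrable_fun mF iZ) => t.
  by rewrite (le_trans (FZ t))// ler_norm.
rewrite (le_trans (le_normr_Rintegral _ iF))//.
by apply: le_Rintegral => //; exact: (integrable_norm iF).
Qed.

(* Taylor's bound [|G (u + h a) - G u - h a g u| <= M h^2 a^2] makes the error of
   the difference quotient at most [|h| M \int |Z| a^2]: no domination argument
   is needed. *)
Lemma is_derive_under_integral (M : R) G g Z u a : C11 M G g ->
  measurable_fun setT u -> measurable_fun setT a ->
  m.-integrable setT (EFin \o Z) ->
  m.-integrable setT (EFin \o (fun t => Z t * a t)) ->
  m.-integrable setT (EFin \o (fun t => Z t * a t ^+ 2)) ->
  is_derive (0 : R) (1 : R) (fun h => \int[m]_t (Z t * G (u t + h * a t)))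
    (\int[m]_t (Z t * a t * g (u t))).
Proof.
move=> cG mu ma iZ iZa iZa2; have M0 := C11_ge0 cG.
have mG := C11_measurable cG; have mg := C11_derive_measurable cG.
have mZ := integrable_measurable iZ.
have [GM dG gM _] := cG.
have mGh h : measurable_fun setT (fun t => G (u t + h * a t)).
  by apply: measurableT_comp => //; apply: measurable_funD => //; apply: measurable_funM.
have iG h : m.-integrable setT (EFin \o (fun t => Z t * G (u t + h * a t))).
  apply: (@integrable_bounded_mul M) => // t.
  by rewrite normrM mulrC ler_wpM2r.
have ig : m.-integrable setT (EFin \o (fun t => Z t * a t * g (u t))).
  apply: (@integrable_bounded_mul M) => //; first exact: measurableT_comp.
  by move=> t; rewrite normrM mulrC ler_wpM2r.
set l := \int[m]_t (Z t * a t * g (u t)).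
set C := M * \int[m]_t `|Z t * a t ^+ 2|.
pose F h := \int[m]_t (Z t * G (u t + h * a t)).
have FC h : `|F h - F 0 - h * l| <= C * h ^+ 2.
  rewrite /F /l -RintegralZl// -RintegralB// -?RintegralB//; last 2 first.
  - exact: integrable_sub.
  - exact: integrable_scale.
  rewrite /C mulrC mulrA -RintegralZl//; last first.
    exact: (integrable_norm iZa2).
  apply: le_norm_Rintegral => //.
  - apply: integrable_measurable; apply: integrable_sub.
      exact: integrable_sub.
    exact: integrable_scale.
  - by apply: integrable_scale; exact: (integrable_norm iZa2).
  move=> t; rewrite mul0r addr0.
  have := C11_taylor cG (u t) (h * a t) => /(ler_wpM2l (normr_ge0 (Z t))).
  rewrite -normrM; move/le_trans => le.
  rewrite (_ : _ - _ = Z t * (G (u t + h * a t) - G (u t) - h * a t * g (u t)));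
    last by ring.
  apply: le; rewrite normrM [in leRHS]normrX real_normK ?num_real//.
  by rewrite le_eqVlt; apply/orP; left; apply/eqP; ring.
have cF : h^-1 *: ((F \o shift 0) (h *: (1 : R)) - F 0) @[h --> 0^'] --> l.
  apply/cvgrPdist_lt => e e0; near=> h.
  have h0 : h != 0 by near: h; exact: nbhs_dnbhs_neq.
  rewrite /= addr0 [h *: (1 : R)]mulr1.
  have C1 : 0 < `|C| + 1 by rewrite ltr_wpDl.
  rewrite distrC -[_ *: _]/(h^-1 * (F h - F 0)).
  rewrite (_ : _ - l = h^-1 * (F h - F 0 - h * l)); last by field.
  rewrite normrM normfV mulrC ltr_pdivrMr ?normr_gt0//.
  rewrite (le_lt_trans (FC h))//.
  rewrite -[h ^+ 2]real_normK ?num_real// expr2 mulrA ltr_pM2r ?normr_gt0//.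
  apply: (@le_lt_trans _ _ ((`|C| + 1) * `|h|)).
    by rewrite ler_wpM2r// ler_wpDr// ler_norm.
  rewrite mulrC -ltr_pdivlMr//; near: h.
  apply: dnbhs0_lt; rewrite divr_gt0//.
split; first by apply/cvg_ex; exists l.
exact/cvg_lim.
Unshelve. all: by end_near. Qed.

End integrability.

(** * Functions annihilated by all ridge functions *)

Section dotv.
Context (R : realType) (n : nat).
Implicit Types (w x y : 'rV[R]_n).

Lemma dotvDl w w' x : dotv (w + w') x = dotv w x + dotv w' x.
Proof.
by rewrite /dotv -big_split /=; apply: eq_bigr => i _; rewrite mxE mulrDl.
Qed.

Lemma dotvZl (k : R) w x : dotv (k *: w) x = k * dotv w x.
Proof.
by rewrite /dotv mulr_sumr; apply: eq_bigr => i _; rewrite mxE mulrA.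
Qed.

Lemma dotvC x y : dotv x y = dotv y x.
Proof. by apply: eq_bigr => i _; rewrite mulrC. Qed.

Lemma dotv_delta i x : dotv (delta_mx 0 i) x = x 0 i.
Proof.
rewrite /dotv (bigD1 i)//= big1 ?addr0 ?mxE ?eqxx ?mul1r// => j ji.
by rewrite mxE (negbTE ji) andbF mul0r.
Qed.

Lemma dotv0 x : dotv 0 x = 0.
Proof. by rewrite /dotv big1// => i _; rewrite mxE mul0r. Qed.

Lemma measurable_dotv d (T : measurableType d) (f g : T -> 'rV[R]_n) :
  measurable_fun setT f -> measurable_fun setT g ->
  measurable_fun setT (fun t => dotv (f t) (g t)).
Proof.
move=> mf mg; rewrite /dotv.
apply: measurable_sum => i; apply: measurable_funM.
  exact: (measurableT_comp (measurable_coord_rV i) mf).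
exact: (measurableT_comp (measurable_coord_rV i) mg).
Qed.

End dotv.

Section discriminatory.
Context (R : realType) (n : nat) (mu : {measure set 'rV[R]_n -> \bar R}).
Variables (Omega : set 'rV[R]_n) (M0 : R).
Hypothesis OmegaM : forall x, Omega x -> forall i, `|x 0 i| <= M0.
Implicit Types (h phi : 'rV[R]_n -> R) (G g : R -> R) (s : seq 'I_n).

(** Extension by zero lets all integrals run over the whole space while multipliers are controlled
    on [Omega] only. *)
Definition supported_integrable h :=
  mu.-integrable setT (EFin \o h) /\ forall x, ~ Omega x -> h x = 0.

Definition annihilates h G :=
  forall w b, \int[mu]_x (h x * G (dotv w x + b)) = 0.

Lemma supported_bounded_mul K h phi : measurable_fun setT phi ->
  (forall x, Omega x -> `|phi x| <= K) -> supported_integrable h ->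
  supported_integrable (fun x => h x * phi x).
Proof.
move=> mphi phiK [ih h0]; split; last by move=> x /h0 ->; rewrite mul0r.
apply: (@integrable_bounded_mul _ _ _ _ K) => // x.
have [Ox|/h0 ->] := pselect (Omega x); last by rewrite mul0r normr0 mulr0.
by rewrite normrM mulrC ler_wpM2r// phiK.
Qed.

Lemma supported_coord h i : supported_integrable h ->
  supported_integrable (fun x => h x * x 0 i).
Proof.
apply: supported_bounded_mul; first exact: measurable_coord_rV.
by move=> x /OmegaM.
Qed.

(** If the difference with step e = v - u were constant, [G] would grow by the same nonzero amount
    [G v - G u] at each step e, against its boundedness. *)
Lemma difference_nonconstant M G : (forall u, `|G u| <= M) ->
  (exists u v, G u != G v) ->
  exists e, exists u v, G (u + e) - G u != G (v + e) - G v.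
Proof.
move=> GM [u [v Guv]]; exists (v - u).
apply: contrapT => /forallNP nc.
have Dc z : G (z + (v - u)) - G z = G v - G u.
  have /forallNP/(_ u) /negP := nc z; rewrite negbK => /eqP ->.
  by rewrite (addrC u) subrK.
have GN N : G (u + (v - u) *+ N) = G u + (G v - G u) *+ N.
  elim: N => [|N IH]; first by rewrite !mulr0n !addr0.
  rewrite !mulrSr [X in G X]addrA [RHS]addrA -IH.
  by rewrite -(Dc (u + (v - u) *+ N)) [RHS]addrC subrK.
have c0 : 0 < `|G v - G u| by rewrite normr_gt0 subr_eq0 eq_sym.
(* After this many steps the growth exceeds 2M, the largest possible oscillation of [G]. *)
pose N := Num.bound ((M + M) / `|G v - G u|).
have : `|(G v - G u) *+ N| <= M + M.
  rewrite (_ : _ *+ N = G (u + (v - u) *+ N) - G u); last by rewrite GN; ring.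
  by rewrite (le_trans (ler_normB _ _))// lerD.
rewrite normrMn leNgt => /negP; apply.
rewrite -mulr_natl -ltr_pdivrMr//.
apply: archi_boundP.
by rewrite divr_ge0// addr_ge0// (le_trans (normr_ge0 (G 0))).
Qed.

(** Moving w along the i-th basis vector by k adds [k * x_i] to the argument of [G]; the integral is
    zero for all k, hence so is its derivative at k = 0. *)
Lemma annihilates_derive M G g h i : C11 M G g -> supported_integrable h ->
  annihilates h G -> annihilates (fun x => h x * x 0 i) g.
Proof.
move=> cG sh hG w b.
have sh1 := supported_coord i sh; have sh2 := supported_coord i sh1.
have mu_u : measurable_fun setT (fun x : 'rV[R]_n => dotv w x + b).
  by apply: measurable_funD => //; apply: measurable_dotv.
have D := @is_derive_under_integral _ _ _ mu M G g h (fun x => dotv w x + b)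
  (fun x => x 0 i) cG mu_u (measurable_coord_rV i) sh.1 sh1.1.
rewrite -(@derive_val _ _ _ _ _ _ _ (D _)); last first.
  by under eq_fun do rewrite expr2 mulrA; exact: sh2.1.
rewrite (_ : (fun k => _) = cst 0); first by rewrite derive_cst.
apply/funext => k; rewrite -[RHS](hG (w + k *: delta_mx 0 i) b).
apply: eq_Rintegral => x _; congr (_ * G _).
by rewrite dotvDl dotvZl dotv_delta addrAC.
Qed.

(* Since [G'] annihilates [h x_i], the integral of [h x_i G(w.x + b)] does not
   depend on b, so that every difference [G(. + e) - G] annihilates [h x_i]. *)
Lemma annihilates_difference M G g h i e : C11 M G g -> supported_integrable h ->
  annihilates h G ->
  annihilates (fun x => h x * x 0 i) (fun u => G (u + e) - G u).
Proof.
move=> cG sh hG w b.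
have sh1 := supported_coord i sh.
have hg := annihilates_derive i cG sh hG.
have mu_u c : measurable_fun setT (fun x : 'rV[R]_n => dotv w x + c).
  by apply: measurable_funD => //; apply: measurable_dotv.
pose F c := \int[mu]_x (h x * x 0 i * G (dotv w x + c)).
have dF (c : R) : is_derive c (1 : R) F 0.
  have D : is_derive (0 : R) (1 : R) (fun k => F (c + k)) 0.
    have D := @is_derive_under_integral _ _ _ mu M G g (fun x => h x * x 0 i)
      (fun x => dotv w x + c) (cst 1) cG (mu_u c) (measurable_cst _) sh1.1.
    rewrite -[X in is_derive _ _ _ X](hg w c).
    rewrite (_ : (fun k => F (c + k)) =
       fun k => \int[mu]_x (h x * x 0 i * G (dotv w x + c + k * cst 1 x))).
      rewrite (_ : \int[mu]_x _ =
        \int[mu]_x (h x * x 0 i * cst 1 x * g (dotv w x + c))).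
        apply: D; first by under eq_fun do rewrite mulr1; exact: sh1.1.
        by under eq_fun do rewrite expr1n mulr1; exact: sh1.1.
      by apply: eq_Rintegral => x _; rewrite mulr1.
    apply/funext => k; apply: eq_Rintegral => x _.
    by rewrite mulr1 addrA.
  rewrite (_ : F = (fun k => F (c + k)) \o (fun y => y - c)); last first.
    by apply/funext => y /=; rewrite addrC subrK.
  rewrite -[X in is_derive _ _ _ X](mul0r 1).
  apply: is_derive1_comp; first by rewrite subrr.
  by rewrite -[X in is_derive _ _ _ X]subr0; apply: is_deriveB.
have cF : F (e + b) = F b by exact: is_derive_0_is_cst.
have [GM _ _ _] := cG.
have iF c : mu.-integrable setT (EFin \o (fun x => h x * x 0 i * G (dotv w x + c))).
  apply: (@integrable_bounded_mul _ _ _ _ M).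
  - by apply: measurableT_comp => //; exact: (C11_measurable cG).
  - exact: sh1.1.
  - by move=> x; rewrite normrM mulrC ler_wpM2r.
rewrite -[RHS](subrr (F b)) -{1}cF -RintegralB//; apply: eq_Rintegral => x _.
by rewrite mulrBr (addrC e) addrA.
Qed.

(** Induction on the monomial, with [M], [G], [g] and [h] all varying: a coordinate moves into [h]
    while [G] becomes one of its nonconstant differences. *)
Lemma annihilates_moments s M G g h : C11 M G g -> (exists u v, G u != G v) ->
  supported_integrable h -> annihilates h G ->
  \int[mu]_x (h x * \prod_(i <- s) x 0 i) = 0.
Proof.
elim: s M G g h => [|i s IH] M G g h cG ncG sh hG.
  have [u Gu] : exists u, G u != 0.
    have [u [v Guv]] := ncG; have [Gu|] := eqVneq (G u) 0; last by exists u.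
    by exists v; rewrite eq_sym -Gu.
  (* With w = 0 the ridge function is the nonzero constant [G u], which leaves the integral of [h]
     itself. *)
  have := hG 0 u.
  under eq_Rintegral do rewrite dotv0 add0r.
  rewrite RintegralZr//; last exact: sh.1.
  move/eqP; rewrite mulf_eq0 (negbTE Gu) orbF => /eqP h0.
  by under eq_Rintegral do rewrite big_nil mulr1.
have [GM dG gM gL] := cG.
have [e ncD] := difference_nonconstant GM ncG.
under eq_Rintegral do rewrite big_cons mulrA.
have M2 : C11 (M + M) (fun u => G (u + e) - G u) (fun u => g (u + e) - g u).
  split.
  - by move=> u; rewrite (le_trans (ler_normB _ _))// lerD.
  - move=> u; apply: is_deriveB.
    rewrite -[X in is_derive _ _ _ X]mulr1.
    apply: (@is_derive1_comp _ G (fun u => u + e)).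
    by rewrite -[X in is_derive _ _ _ X]addr0; apply: is_deriveD.
  - by move=> u; rewrite (le_trans (ler_normB _ _))// lerD.
  - move=> u v; rewrite (_ : _ - _ = g (u + e) - g (v + e) - (g u - g v)).
      rewrite (le_trans (ler_normB _ _))// mulrDl lerD//.
      by rewrite (le_trans (gL _ _))// opprD addrACA subrr addr0.
    by ring.
apply: (IH _ _ _ _ M2 ncD); first exact: supported_coord.
exact: annihilates_difference cG sh hG.
Qed.

(** * Multipliers preserving vanishing moments *)

Definition moment_free h := supported_integrable h /\
  forall s, \int[mu]_x (h x * \prod_(i <- s) x 0 i) = 0.

(** Phrased as preservation of a class, the property passes to products by composition, whereas
    orthogonality of a single h to phi would not be multiplicative. *)
Definition moment_multiplier phi := [/\ measurable_fun setT phi,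
  exists K, forall x, Omega x -> `|phi x| <= K &
  forall h, moment_free h -> moment_free (fun x => h x * phi x)].

Lemma supported_monomial s h : supported_integrable h ->
  supported_integrable (fun x => h x * \prod_(i <- s) x 0 i).
Proof.
elim: s h => [|i s IH] h sh.
  by under eq_fun do rewrite big_nil mulr1.
by under eq_fun do rewrite big_cons mulrA; apply/IH/supported_coord.
Qed.

Lemma multiplier_cst k : moment_multiplier (cst k).
Proof.
split; [exact: measurable_cst|by exists (`|k| : R)|].
move=> h [sh h0]; split; first by apply: (@supported_bounded_mul `|k|).
move=> s; under eq_Rintegral do rewrite mulrAC.
by rewrite RintegralZr// ?h0 ?mul0r//; exact: (supported_monomial s sh).1.
Qed.

Lemma multiplier_coord i : moment_multiplier (fun x => x 0 i).
Proof.
split; [exact: measurable_coord_rV|by exists M0 => x /OmegaM|].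
move=> h [sh h0]; split; first exact: supported_coord.
move=> s; rewrite -[RHS](h0 (i :: s)); apply: eq_Rintegral => x _.
by rewrite big_cons mulrA.
Qed.

Lemma multiplierD phi psi : moment_multiplier phi -> moment_multiplier psi ->
  moment_multiplier (fun x => phi x + psi x).
Proof.
move=> [mphi [K phiK] hphi] [mpsi [L psiL] hpsi].
have KL x : Omega x -> `|phi x + psi x| <= K + L.
  by move=> Ox; rewrite (le_trans (ler_normD _ _))// lerD ?phiK ?psiL.
have mD : measurable_fun setT (fun x => phi x + psi x) by exact: measurable_funD.
split=> //; first by exists (K + L).
move=> h hmf; have [sh h0] := hmf; split; first exact: supported_bounded_mul KL _.
move=> s; under eq_Rintegral do rewrite mulrDr mulrDl.
have [s1 h1] := hphi _ hmf; have [s2 h2] := hpsi _ hmf.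
by rewrite RintegralD// ?h1 ?h2 ?addr0//; apply: (supported_monomial s _).1.
Qed.

Lemma multiplierM phi psi : moment_multiplier phi -> moment_multiplier psi ->
  moment_multiplier (fun x => phi x * psi x).
Proof.
move=> [mphi [K phiK] hphi] [mpsi [L psiL] hpsi]; split.
- exact: measurable_funM.
- by exists (K * L) => x Ox; rewrite normrM ler_pM ?phiK ?psiL.
- by move=> h /hphi/hpsi; under eq_fun do rewrite -mulrA.
Qed.

Lemma multiplierX phi k : moment_multiplier phi ->
  moment_multiplier (fun x => phi x ^+ k).
Proof.
move=> mphi; elim: k => [|k IH]; first exact: (multiplier_cst 1).
by under eq_fun do rewrite exprS; exact: multiplierM.
Qed.

Lemma multiplierBr k phi : moment_multiplier phi ->
  moment_multiplier (fun x => k - phi x).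
Proof.
move=> mphi; apply: multiplierD; first exact: multiplier_cst.
by under eq_fun do rewrite -mulN1r; apply: multiplierM => //; exact: multiplier_cst.
Qed.

(** Dominated convergence for each monomial, with dominating function [K * |h * monomial|]. Outside
    [Omega] all integrands vanish, so convergence is only asked inside. *)
Lemma multiplier_lim (K : R) (phi_ : nat -> 'rV[R]_n -> R) phi :
  (forall k, moment_multiplier (phi_ k)) ->
  (forall k x, Omega x -> `|phi_ k x| <= K) -> measurable_fun setT phi ->
  (forall x, Omega x -> phi_ k x @[k --> \oo] --> phi x) ->
  moment_multiplier phi.
Proof.
move=> hphi phiK mphi cvphi.
have phi_K x : Omega x -> `|phi x| <= K.
  move=> Ox; have cv : `|phi_ k x| @[k --> \oo] --> (`|phi x| : R).
    by apply: cvg_norm; exact: cvphi.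
  apply: (cvgr_to_le cv); by apply: nearW => k; exact: phiK.
split=> //; first by exists K.
move=> h hmf; have [sh h0] := hmf; split; first exact: supported_bounded_mul phi_K _.
move=> s.
have shs := supported_monomial s sh.
pose ms x := h x * \prod_(i <- s) x 0 i.
have mms : measurable_fun setT ms := integrable_measurable shs.1.
have mk k : measurable_fun setT (phi_ k) by case: (hphi k).
have [] := @dominated_convergence _ _ _ mu setT measurableT
  (fun k x => (ms x * phi_ k x)%:E) (fun x => (ms x * phi x)%:E)
  (fun x => (K * `|ms x|)%:E).
- by move=> k; apply/measurable_EFinP; exact: measurable_funM.
- by apply/measurable_EFinP; exact: measurable_funM.
- apply: aeW => x _; apply: cvg_EFin; first exact: nearW.
  have [Ox|nOx] := pselect (Omega x); first by apply: cvgM; [exact: cvg_cst|exact: cvphi].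
  rewrite /ms (sh.2 _ nOx) !mul0r.
  by under eq_fun do rewrite mul0r; exact: cvg_cst.
- by apply: (@integrable_scale _ _ _ mu); exact: (integrable_norm shs.1).
- apply: aeW => x k _; rewrite lee_fin /ms.
  have [Ox|nOx] := pselect (Omega x).
    by rewrite normrM mulrC ler_wpM2r// phiK.
  by rewrite (sh.2 _ nOx) !mul0r normr0 mulr0.
move=> _ _; rewrite (_ : [sequence _]_k = cst 0%E).
  move=> /(cvg_lim (@ereal_hausdorff R)); rewrite lim_cst//.
  rewrite /Rintegral => e; under eq_integral do rewrite mulrAC.
  by rewrite -e.
apply/funext => k /=; have [_ h0k] := (let: And3 _ _ H := hphi k in H _ hmf).
have ik : mu.-integrable setT (fun x => (ms x * phi_ k x)%:E).
  have [_ [L phiL] _] := hphi k.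
  have := @supported_bounded_mul L _ _ (mk k) phiL shs.
  by case.
rewrite -[LHS]fineK; last exact: integrable_fin_num.
by under eq_integral do rewrite /ms mulrAC; rewrite -/(Rintegral _ _ _) h0k.
Qed.

(** Polynomials of the type used in the elementary proof of the Stone-Weierstrass theorem,
    converging on [0, 1] to a step at 1/2. The exponent N = k 2^k makes N y^k = k (2y)^k, which
    tends to 0 for y < 1/2 and to infinity for y >= 1/2; the factor k settles the case y = 1/2. *)
Definition power_step (k : nat) (y : R) : R := (1 - y ^+ k) ^+ (k * 2 ^ k).

Lemma power_step_itv k y : 0 <= y <= 1 -> 0 <= power_step k y <= 1.
Proof.
move=> /andP[y0 y1]; have /andP[p0 p1] : 0 <= 1 - y ^+ k <= 1.
  by rewrite subr_ge0 exprn_ile1//= gerDl oppr_le0 exprn_ge0.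
by rewrite exprn_ge0// exprn_ile1.
Qed.

Lemma bernoulli_ineq (x : R) k : -1 <= x -> 1 + k%:R * x <= (1 + x) ^+ k.
Proof.
move=> x1; elim: k => [|k IH]; first by rewrite mul0r addr0 expr0.
have x0 : 0 <= 1 + x by rewrite -lerBlDl sub0r.
rewrite exprS; apply: le_trans (ler_wpM2l x0 IH).
rewrite -subr_ge0 (_ : _ - _ = k%:R * x ^+ 2); last by rewrite -natr1; ring.
by rewrite mulr_ge0// sqr_ge0.
Qed.

(* Bernoulli's inequality, below 1/2 on [(1 - y^k)^N] and above 1/2 on
   [(1 + y^k)^N <= (1 - y^k)^-N]. *)
Lemma power_step_cvg y : 0 <= y <= 1 ->
  power_step k y @[k --> \oo] --> (if y < 2^-1 then 1 else 0 : R).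
Proof.
move=> y01; have /andP[y0 y1] := y01; case: ltP => y2.
(* The midpoint of 2y and 1 satisfies 2y <= s^2 < 1. Hence k (2y)^k <= (k s^k) s^k, where the first
   factor stays bounded and the second decays geometrically. *)
- pose s : R := (1 + 2 * y) / 2.
  have s0 : 0 < s by rewrite /s; lra.
  have s1 : s < 1 by rewrite /s; lra.
  have rs : 2 * y <= s ^+ 2.
    rewrite -subr_ge0 (_ : _ - _ = ((1 - 2 * y) / 2) ^+ 2) ?sqr_ge0//.
    by rewrite /s; field.
  have ks k : k%:R * s ^+ k <= s / (1 - s).
    have := @bernoulli_ineq (s^-1 - 1) k _.
    rewrite subrKC exprVn => /(_ _)/le_trans h.
    have ss : 0 < s^-1 - 1 by rewrite subr_gt0 invf_gt1.
    rewrite -[s / _]invrK invf_div mulrBl divff ?gt_eqF// div1r.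
    rewrite -[leRHS]mul1r ler_pdivlMr// mulrAC -ler_pdivlMr ?exprn_gt0//.
    rewrite div1r (le_trans _ (h _ _ (lexx _)))//; first by rewrite lerDr.
    by rewrite (le_trans _ (ltW ss))// lerN10.
  apply: (@squeeze_cvgr _ _ _ _ (fun k => 1 - s / (1 - s) * s ^+ k) (cst 1)).
  + apply: nearW => k; have /andP[_ ->] := power_step_itv k y01; rewrite andbT.
    apply: le_trans (bernoulli_ineq _ _); last first.
      by rewrite lerN2 exprn_ile1.
    rewrite mulrN lerD2l lerN2 natrM natrX -[leLHS]mulrA -exprMn.
    apply: (@le_trans _ _ (k%:R * (s ^+ k * s ^+ k))).
      by rewrite ler_wpM2l// -expr2 exprAC lerXn2r ?nnegrE ?sqr_ge0 ?mulr_ge0.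
    by rewrite mulrA ler_wpM2r// exprn_ge0// ltW.
  + rewrite -[X in _ --> X]subr0; apply: cvgB; first exact: cvg_cst.
    by apply: cvg_geometric; rewrite gtr0_norm.
  + exact: cvg_cst.
- apply: (@squeeze_cvgr _ _ _ _ (cst 0) (fun k => k.+1%:R^-1)).
  + apply: nearW => k; have /andP[-> _] := power_step_itv k y01; rewrite /=.
    have yk0 : 0 <= y ^+ k by rewrite exprn_ge0.
    have yk1 : y ^+ k <= 1 by rewrite exprn_ile1.
    have B : k.+1%:R <= (1 + y ^+ k) ^+ (k * 2 ^ k).
      apply: le_trans (bernoulli_ineq _ _); last exact: le_trans yk0.
      rewrite -natr1 addrC lerD2l natrM natrX -mulrA -exprMn.
      by rewrite ler_peMr// exprn_ege1// mulrC -ler_pdivrMr// div1r.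
    rewrite -[leRHS]mul1r ler_pdivlMr// (le_trans (ler_wpM2l _ B))//.
      by have /andP[] := power_step_itv k y01.
    rewrite /power_step -exprMn exprn_ile1//.
      by rewrite mulr_ge0// ?subr_ge0// addr_ge0.
    rewrite -subr_ge0 (_ : _ - _ = y ^+ k * y ^+ k); last by ring.
    exact: mulr_ge0.
  + exact: cvg_cst.
  + exact: cvg_harmonic.
Qed.

Lemma measurable_coord_lt i (a : R) :
  measurable [set x : 'rV[R]_n | x 0 i < a].
Proof.
have := measurable_coord_rV i measurableT (measurable_itv `]-oo, a[).
rewrite setTI (_ : _ @^-1` _ = [set x : 'rV[R]_n | x 0 i < a])//.
Qed.

(** An affine function of [x_i] maps [Omega] into [0, 1] and the hyperplane [x_i = a] to 1/2;
    composing it with the polynomial steps gives the indicator in the limit. *)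
Lemma multiplier_indic_lt i (a : R) :
  moment_multiplier (\1_[set x : 'rV[R]_n | x 0 i < a]).
Proof.
(* [L] bounds [|x_i - a|] on [Omega]; the added 1 keeps it positive. *)
pose L := `|M0| + `|a| + 1.
have L0 : 0 < L by rewrite ltr_wpDl// addr_ge0.
pose y (x : 'rV[R]_n) := 2^-1 + (x 0 i - a) * (2 * L)^-1.
have my : moment_multiplier y.
  apply: multiplierD; first exact: multiplier_cst.
  apply: multiplierM; last exact: multiplier_cst.
  by apply: multiplierD; [exact: multiplier_coord|exact: multiplier_cst].
have y01 x : Omega x -> 0 <= y x <= 1.
  move=> Ox; have xL : `|x 0 i - a| <= L.
    rewrite (le_trans (ler_normB _ _))// /L ler_wpDr// lerD2r.
    by rewrite (le_trans (OmegaM Ox i))// ler_norm.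
  have : `|(x 0 i - a) * (2 * L)^-1| <= 2^-1.
    rewrite normrM normfV (gtr0_norm (mulr_gt0 _ L0))// invfM.
    by rewrite mulrCA -[leRHS]mulr1 ler_wpM2l// ler_pdivrMr// mul1r.
  by rewrite ler_norml /y => /andP[? ?]; apply/andP; split; lra.
apply: (@multiplier_lim 1 (fun k x => power_step k (y x))).
- by move=> k; apply: multiplierX; apply: multiplierBr; exact: multiplierX.
- move=> k x Ox; have /andP[p0 p1] := power_step_itv k (y01 x Ox).
  by rewrite ger0_norm.
- by apply: measurable_indic; exact: measurable_coord_lt.
move=> x Ox; have := power_step_cvg (y01 x Ox).
suff -> : (if y x < 2^-1 then 1 else 0 : R) = \1_[set x | x 0 i < a] x by [].
rewrite indicE /y gtrDl pmulr_llt0 ?invr_gt0 ?mulr_gt0// subr_lt0.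
case: ltP => xa; first by rewrite mem_set.
by rewrite memNset//=; apply/negP; rewrite -leNgt.
Qed.

Let indicC1 (A : set 'rV[R]_n) : \1_(~` A) = (fun x => 1 - \1_A x) :> (_ -> R).
Proof.
apply/funext => x; rewrite indicC indicE.
by case: (_ \in _); rewrite ?subrr ?subr0.
Qed.

Let mult_sets : set (set 'rV[R]_n) :=
  [set A | measurable A /\ moment_multiplier (\1_A)].

(** Complements come from 1 - phi, finite unions from products by De Morgan, countable unions as
    bounded limits. Closure under products spares a monotone class argument. *)
Lemma multiplier_sigma_algebra : sigma_algebra setT mult_sets.
Proof.
split.
- by split=> //; rewrite indic0; exact: multiplier_cst.
- move=> A [mA hA]; rewrite setTD; split; first exact: measurableC.
  by rewrite indicC1; exact: multiplierBr.
- move=> A hA; have mUA : measurable (\bigcup_i A i).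
    by apply: bigcup_measurable => k _; case: (hA k).
  split=> //.
  have mU k : moment_multiplier (\1_(\big[setU/set0]_(i < k) A i)).
    elim: k => [|k IH]; first by rewrite big_ord0 indic0; exact: multiplier_cst.
    rewrite big_ord_recr /= -[X in \1_X]setCK setCU indicC1.
    apply: multiplierBr; rewrite indicI.
    apply: multiplierM; rewrite indicC1; first exact: multiplierBr.
    by apply: multiplierBr; case: (hA k).
  apply: (@multiplier_lim 1 (fun k => \1_(\big[setU/set0]_(i < k) A i))) => //.
  + by move=> k x _; rewrite indicE; case: (_ \in _); rewrite ?normr1 ?normr0.
  move=> x _; rewrite [X in _ --> X]indicE.
  have [[i _ Aix]|nA] := pselect ((\bigcup_i A i) x).
    rewrite mem_set; last by exists i.
    apply: cvg_near_cst; exists i.+1 => // k /= ik.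
    by rewrite indicE mem_set// -bigcup_mkord; exists i.
  rewrite memNset//; apply: cvg_near_cst; apply: nearW => k.
  rewrite indicE memNset// -bigcup_mkord => -[i _ Aix].
  by apply: nA; exists i.
Qed.

(** The identity, from the space with the sigma-algebra [mult_sets] to the Borel space, is
    measurable as soon as its coordinates are. This reduces Borel sets to half-spaces orthogonal to
    the axes. *)
Lemma multiplier_measurable (A : set 'rV[R]_n) : measurable A ->
  moment_multiplier (\1_A).
Proof.
move=> mA.
have mid : measurable_fun setT
    (fun x : g_sigma_algebraType mult_sets => x : 'rV[R]_n).
  apply: measurable_fun_rV => i.
  apply: (measurability _ (RGenInftyO.measurableE R)) => _ [_ [a ->] <-].
  rewrite setTI (_ : _ @^-1` _ = [set x : 'rV[R]_n | x 0 i < a]).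
    apply: sub_gen_smallest; split; first exact: measurable_coord_lt.
    exact: multiplier_indic_lt.
  by apply/seteqP; split => x; rewrite /= in_itv.
have := mid measurableT A mA; rewrite setTI preimage_id => AG.
have : <<s mult_sets >> A by exact: AG.
by rewrite sigma_algebra_id; [case|exact: multiplier_sigma_algebra].
Qed.

(** The empty monomial, applied to [h] times the indicator of E, says that the integral of [h] over
    any Borel set E is zero. *)
Lemma moment_free_ae0 h : moment_free h -> ae_eq mu setT h (cst 0).
Proof.
move=> hh; have [sh _] := hh.
have : ae_eq mu setT (EFin \o h) (cst 0%E).
  apply: integral_ae_eq => //; first exact: sh.1.
  move=> E _ mE; have [_ _ /(_ _ hh)[shE /(_ [::])]] := multiplier_measurable mE.
  under eq_Rintegral do rewrite big_nil mulr1.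
  rewrite integral0 integral_mkcond => e.
  rewrite (_ : _ \_ E = EFin \o (fun x => h x * \1_E x)).
    rewrite -[LHS]fineK ?e//; first by congr EFin.
    by apply: integrable_fin_num => //; exact: shE.1.
  apply/funext => x; rewrite /patch /= indicE; case: (_ \in _).
    by rewrite mulr1.
  by rewrite mulr0.
by apply: filterS => x + _ => /(_ Logic.I)[].
Qed.

Lemma discriminatory M G g h : C11 M G g -> (exists u v, G u != G v) ->
  supported_integrable h -> annihilates h G -> ae_eq mu setT h (cst 0).
Proof.
move=> cG ncG sh hG; apply: moment_free_ae0; split=> // s.
exact: annihilates_moments cG ncG sh hG.
Qed.

End discriminatory.

(** * Sobolev norms *)

Section L2norm.
Context d (T : measurableType d) (R : realType) (mu : {measure set T -> \bar R}).
Variable D : set T.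
Hypothesis mD : measurable D.
Implicit Types u v : T -> R.

Lemma measurable_mul_indic u : measurable_fun D u ->
  measurable_fun setT (fun x => u x * \1_D x).
Proof.
move=> mu'; have := (measurable_restrictT u mD).1 mu'.
rewrite (_ : u \_ D = (fun x => u x * \1_D x))//.
apply/funext => x; rewrite /patch indicE; case: (_ \in _).
  by rewrite mulr1.
by rewrite mulr0.
Qed.

Lemma L2normD u v : measurable_fun D u -> measurable_fun D v ->
  (L2norm mu D (fun x => (u x + v x)%R) <= L2norm mu D u + L2norm mu D v)%E.
Proof.
move=> mu' mv; rewrite /L2norm.
have := @minkowski_EFin _ _ _ mu _ _ 2 (measurable_mul_indic mu')
  (measurable_mul_indic mv).
rewrite ler1n => /(_ isT); apply: le_trans; rewrite le_eqVlt; apply/orP; left.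
by apply/eqP; apply: eq_Lnorm => x /=; rewrite mulrDl.
Qed.

Lemma L2normZ (k : R) u : measurable_fun D u ->
  L2norm mu D (fun x => k * u x) = (`|k|%:E * L2norm mu D u)%E.
Proof.
move=> mu'; rewrite /L2norm unlock.
have mU : measurable_fun setT (fun x => (`|(u x * \1_D x)%:E| `^ 2)%E).
  apply: (measurableT_comp (measurable_poweR 2)).
  by apply: measurableT_comp => //; apply/measurable_EFinP/measurable_mul_indic.
under eq_integral do rewrite -mulrA EFinM abseM poweRM ?abse_ge0//.
rewrite ge0_integralZl//; last 2 first.
- by move=> x _; exact: poweR_ge0.
- exact: poweR_ge0.
rewrite poweRM ?poweR_ge0 ?integral_ge0//; last by move=> x _; exact: poweR_ge0.
congr (_ * _)%E; rewrite -poweRrM.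
  by rewrite divff// poweRe1.
Qed.

Lemma L2norm_cst0 : L2norm mu D (cst 0) = 0%E.
Proof.
rewrite /L2norm -[RHS](@Lnorm0 _ _ _ mu 2%:E) ?eqe ?pnatr_eq0//.
by apply: eq_Lnorm => x; rewrite /= mul0r.
Qed.

End L2norm.

Lemma L2norm_eq d (T : measurableType d) (R : realType)
    (mu : {measure set T -> \bar R}) (D : set T) (u v : T -> R) :
  (forall x, D x -> u x = v x) -> L2norm mu D u = L2norm mu D v.
Proof.
move=> uv; apply: eq_Lnorm => x; rewrite indicE.
by have [/set_mem/uv ->|] := boolP (x \in D); rewrite ?mulr0.
Qed.

(** * Finiteness and null sets of a measure with a density *)

Section lebesgue_rV_theory.
Context (R : realType) (n : nat).

Lemma lebesgue_rV_cube (M : R) :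
  (lebesgue_rV n [set x : 'rV[R]_n | (forall i, `|x 0 i| <= M)%R] < +oo)%E.
Proof.
elim: n => [|k IH] /=.
  by rewrite diracE; case: (_ \in _); rewrite ltry.
rewrite /lebesgue_cons /pushforward /=.
rewrite (_ : _ @^-1` _ =
    `[- M, M] `*` [set x : 'rV[R]_k | (forall i, `|x 0 i| <= M)]).
  rewrite product_measure1E//.
    rewrite lte_mul_pinfty//.
    have := lebesgue_measure_itv `[- M, M]; rewrite /=.
    by case: ifP => _ e; [rewrite [X in X \is a _]e -EFinB|rewrite [X in X \is a _]e].
  rewrite (_ : [set x | _] = \bigcap_(i in setT) (fun x : 'rV[R]_k => x 0 i) @^-1` `[- M, M]).
    apply: fin_bigcap_measurable => //.
    move=> i _; rewrite -[X in measurable X]setTI.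
    exact: measurable_coord_rV.
  apply/seteqP; split=> x /= h i; first by move=> _; rewrite /= in_itv /= -ler_norml.
  by have := h i Logic.I; rewrite /= in_itv /= -ler_norml.
apply/seteqP; split=> -[a x] /=.
  move=> h; split.
    by have := h ord0; rewrite mxE unlift_none /= in_itv /= -ler_norml.
  by move=> i; have := h (lift ord0 i); rewrite mxE liftK.
move=> [h1 h2] i; rewrite mxE; case: (unliftP ord0 i) => [j|] _ /=; first exact: h2.
by move: h1; rewrite in_itv /= -ler_norml.
Qed.

Lemma coord_le_norm (x : 'rV[R]_n) i : `|x 0 i| <= `|x|.
Proof.
rewrite [leRHS]mx_normrE.
exact: (le_bigmax _ (fun ij : 'I_1 * 'I_n => `|x ij.1 ij.2|) (0, i)).
Qed.

Lemma bounded_set_coord (A : set 'rV[R]_n) : bounded_set A ->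
  exists M, forall x, A x -> forall i, `|x 0 i| <= M.
Proof.
move=> [M [_ AM]]; exists (M + 1) => x Ax i.
rewrite (le_trans (coord_le_norm x i))//.
by apply: (AM (M + 1)) => //; rewrite ltrDl.
Qed.

End lebesgue_rV_theory.

Section density.
Context (R : realType) (n : nat) (Omega : set 'rV[R]_n).
Context (mu : {measure set 'rV[R]_n -> \bar R}).
Hypotheses (oO : open Omega) (bO : bounded_set Omega).
Hypothesis dmu : continuous_density Omega mu.

Let mO : measurable Omega := open_measurable_rV oO.

Lemma measurable_fun_open_continuous (rho : 'rV[R]_n -> R) :
  (forall x, Omega x -> {for x, continuous rho}) -> measurable_fun Omega rho.
Proof.
move=> crho; apply: (measurability _ (RGenOInfty.measurableE R)) => //.
move=> _ [_ [a ->] <-]; apply: open_measurable_rV.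
rewrite openE => x [Ox /= ax].
apply: filterI; first exact: open_nbhs_nbhs.
by apply: (crho x Ox); exact: open_nbhs_nbhs.
Qed.

Lemma density_finite : (mu setT < +oo)%E.
Proof.
have [rho [crho [m [M [m0 mM]]] ->]] := dmu => //; rewrite setTI.
have [K OK] := bounded_set_coord bO.
have M0 x : Omega x -> 0 <= M.
  by move=> /mM/andP[mr rM]; rewrite (le_trans (ltW m0))// (le_trans mr).
apply: (@le_lt_trans _ _ (\int[lebesgue_rV n]_(x in Omega) (M%:E))%E).
  apply: ge0_le_integral => //.
  - by move=> x /mM/andP[+ _]; rewrite lee_fin => /(le_trans (ltW m0)).
  - by apply/measurable_EFinP; exact: measurable_fun_open_continuous.
  - by move=> x /mM/andP[].
rewrite integral_cst//.
(* When [Omega] is empty the upper bound [M] of the density has no known sign. *)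
have [->|/set0P[x /M0 M0']] := eqVneq Omega set0; first by rewrite measure0 mule0.
rewrite lte_mul_pinfty//.
apply: le_lt_trans (lebesgue_rV_cube n K).
apply: le_measure; rewrite ?inE//.
rewrite (_ : [set x | _] = \bigcap_(i in setT) (fun x : 'rV[R]_n => x 0 i) @^-1` `[- K, K]).
  apply: fin_bigcap_measurable => // i _; rewrite -[X in measurable X]setTI.
  exact: measurable_coord_rV.
apply/seteqP; split=> y /= h i; first by move=> _; rewrite /= in_itv /= -ler_norml.
by have := h i Logic.I; rewrite /= in_itv /= -ler_norml.
Qed.

(** The density is at least m > 0 on [Omega]. The passage to Lebesgue measure is needed because the
    initial condition holds [mu]-almost everywhere, while weak derivatives are tested against
    Lebesgue measure. *)
Lemma density_negligible (P : set 'rV[R]_n) :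
  {ae mu, forall x, Omega x -> P x} ->
  {ae lebesgue_rV n, forall x, Omega x -> P x}.
Proof.
have [rho [crho [m [M [m0 mM]]] emu]] := dmu.
move=> [N [mN N0 PN]]; exists (N `&` Omega); split.
- exact: measurableI.
- have mNO : measurable (N `&` Omega) by exact: measurableI.
  have : (m%:E * lebesgue_rV n (N `&` Omega) <= 0)%E.
    rewrite -N0 emu// -integral_cst//.
    apply: ge0_le_integral => //.
    + by move=> x _; rewrite lee_fin ltW.
    + apply/measurable_EFinP; apply: measurable_funS mO _ _; first exact: subIsetr.
      exact: measurable_fun_open_continuous.
    + by move=> x [_ /mM/andP[]].
  rewrite -[X in (_ <= X)%E](mule0 m%:E) lee_pmul2l ?lte_fin// => h.
  by apply/eqP; rewrite eq_le h measure_ge0.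
- move=> x /= nP; have Ox : Omega x by apply: contrapT => nO; apply: nP => /nO.
  by split=> //; apply: PN => /= h; apply: nP => _; exact: h.
Qed.

End density.

(** * Algebra of functions of class C^1 *)

Section C1.
Context (R : realType) (n : nat).
Implicit Types u v : 'rV[R]_n -> R.

Lemma Ck1P u : Ck setT 1 u <-> [/\ continuous u,
  forall i x, derivable u x (delta_mx 0 i) & forall i, continuous (partial i u)].
Proof.
split=> [uC|[cu du cpu] s].
  split.
  - by move=> x; have [/(_ x Logic.I)] := uC [::] isT.
  - by move=> i x; have [_ /(_ isT i x Logic.I)] := uC [::] isT.
  - by move=> i x; have [/(_ x Logic.I)] := uC [:: i] isT.
case: s => [|i [|//]] _; split=> //=.
- by move=> x _; exact: cu.
- by move=> x _; exact: cpu.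
Qed.

Lemma Ck1D u v : Ck setT 1 u -> Ck setT 1 v -> Ck setT 1 (fun x => u x + v x).
Proof.
move=> /Ck1P[cu du cpu] /Ck1P[cv dv cpv]; apply/Ck1P; split.
- by move=> x; exact: (continuousD (cu x) (cv x)).
- by move=> i x; exact: derivableD.
- move=> i; rewrite (_ : partial i _ = partial i u + partial i v).
    by move=> x; exact: (continuousD (cpu i x) (cpv i x)).
  by apply/funext => x; exact: deriveD.
Qed.

Lemma Ck1M u v : Ck setT 1 u -> Ck setT 1 v -> Ck setT 1 (fun x => u x * v x).
Proof.
move=> /Ck1P[cu du cpu] /Ck1P[cv dv cpv]; apply/Ck1P; split.
- by move=> x; exact: (continuousM (cu x) (cv x)).
- by move=> i x; exact: derivableM.
- move=> i.
  rewrite (_ : partial i _ = fun x => u x * partial i v x + v x * partial i u x).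
    move=> x; exact: (continuousD (continuousM (cu x) (cpv i x))
      (continuousM (cv x) (cpu i x))).
  by apply/funext => x; exact: deriveM.
Qed.

Lemma Ck1_cst (k : R) : Ck setT 1 (cst k : 'rV[R]_n -> R).
Proof.
apply/Ck1P; split; first exact: cst_continuous.
- by move=> i x; exact: derivable_cst.
- move=> i; rewrite (_ : partial i _ = cst 0); first exact: cst_continuous.
  by apply/funext => x; exact: derive_cst.
Qed.

Lemma Ck1Z (k : R) u : Ck setT 1 u -> Ck setT 1 (fun x => k * u x).
Proof. by move=> uC; apply: Ck1M => //; exact: Ck1_cst. Qed.

Lemma Ck1_sum (I : Type) (r : seq I) (u : I -> 'rV[R]_n -> R) :
  (forall i, Ck setT 1 (u i)) -> Ck setT 1 (fun x => \sum_(i <- r) u i x).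
Proof.
move=> uC; elim: r => [|i r IH].
  by under eq_fun do rewrite big_nil; exact: Ck1_cst.
by under eq_fun do rewrite big_cons; exact: Ck1D.
Qed.

End C1.

(** The common source of two triangle inequalities: for Sobolev norms, which are infima over weak
    derivatives, and for the distance to a vector space of functions. *)
Lemma ereal_inf_le_add (R : realType) (A B C : set (\bar R)) :
  (forall a, A a -> 0 <= a)%E -> (forall b, B b -> 0 <= b)%E ->
  (forall a b, A a -> B b -> exists2 c, C c & c <= a + b)%E ->
  (ereal_inf C <= ereal_inf A + ereal_inf B)%E.
Proof.
move=> A0 B0 ABC.
have iA0 : (0 <= ereal_inf A)%E by apply: le_ereal_inf_tmp => a; exact: A0.
have iB0 : (0 <= ereal_inf B)%E by apply: le_ereal_inf_tmp => b; exact: B0.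
have [->|Aoo] := eqVneq (ereal_inf A) +oo%E.
  by rewrite addye ?leey// -ltNye (lt_le_trans _ iB0).
have [->|Boo] := eqVneq (ereal_inf B) +oo%E.
  by rewrite addey ?leey// -ltNye (lt_le_trans _ iA0).
have fA : ereal_inf A \is a fin_num by rewrite ge0_fin_numE// ltey.
have fB : ereal_inf B \is a fin_num by rewrite ge0_fin_numE// ltey.
apply/lee_addgt0Pr => e e0.
have e20 : 0 < e / 2 by rewrite divr_gt0.
have [a Aa aA] := lb_ereal_inf_adherent e20 fA.
have [b Bb bB] := lb_ereal_inf_adherent e20 fB.
have [c Cc cab] := ABC a b Aa Bb.
apply: (le_trans (ereal_inf_lbound Cc)); apply: (le_trans cab).
rewrite [X in (_ + X%:E)%E](splitr e) EFinD addeACA.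
by rewrite leeD// ltW.
Qed.

(** * Weak derivatives and Sobolev norms *)

Section sobolev_theory.
Context (R : realType) (n : nat) (Omega : set 'rV[R]_n).
Context (mu : {measure set 'rV[R]_n -> \bar R}).
Hypotheses (oO : open Omega).
Implicit Types (u v : 'rV[R]_n -> R) (s : seq 'I_n).

Let mO : measurable Omega := open_measurable_rV oO.

Lemma compact_measurable_rV (K : set 'rV[R]_n) : compact K -> measurable K.
Proof.
move=> cK; rewrite -[K]setCK; apply: measurableC; apply: open_measurable_rV.
by rewrite openC; apply: compact_closed => //; exact: norm_hausdorff.
Qed.

Lemma test_partials_continuous phi s : test_function Omega phi ->
  continuous (partials s phi).
Proof. by move=> [/(_ (size s) s (leqnn _))[+ _] _] x; apply. Qed.

Lemma partials_eq0 (K : set 'rV[R]_n) phi s : closed K ->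
  (forall x, ~ K x -> phi x = 0) -> forall x, ~ K x -> partials s phi x = 0.
Proof.
move=> cK phi0; elim: s => [//|i s IH] x nKx /=.
rewrite /partial (@near_eq_derive _ _ _ _ (cst 0)) ?derive_cst//.
have : nbhs x (~` K) by apply: open_nbhs_nbhs; split => //; rewrite openC.
by apply: filterS => y; exact: IH.
Qed.

(** The derivatives of [phi] vanish off its compact support K, as the complement of K is open; so
    only the integrability of [u] on K matters. *)
Lemma integrable_mul_test u phi s : locally_integrable_on Omega u ->
  test_function Omega phi ->
  (lebesgue_rV n).-integrable Omega (EFin \o (fun x => u x * partials s phi x)).
Proof.
move=> [mu' iu] tphi; have cphi : continuous (partials s phi) := test_partials_continuous tphi.
have [_ [K [cK KO] phi0]] := tphi.
have clK : closed K by apply: compact_closed => //; exact: norm_hausdorff.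
have mK := compact_measurable_rV cK.
have p0 := partials_eq0 s clK phi0.
have iK : (lebesgue_rV n).-integrable K (EFin \o (fun x => u x * partials s phi x)).
  apply: (integrableMl mK (iu K cK KO)).
    apply: measurable_funS measurableT _ _ => //.
    exact: continuous_measurable_rV.
  have /compact_bounded[M [Mr HM]] : compact (partials s phi @` K).
    by apply: continuous_compact => //; exact: continuous_subspaceT.
  by exists M; split=> // N MN x Kx; apply: HM => //; exists x.
apply/(integrable_mkcond _ mO).
rewrite (_ : _ \_ Omega = (EFin \o (fun x => u x * partials s phi x)) \_ K).
  exact/(integrable_mkcond _ mK).
apply/funext => x; rewrite /patch.
have [/set_mem Kx|/negP nK] := boolP (x \in K).
  by rewrite mem_set//; exact: KO.
case: ifPn => // _ /=; rewrite p0 ?mulr0// => Kx.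
by apply: nK; rewrite inE.
Qed.

Lemma locally_integrableD u v : locally_integrable_on Omega u ->
  locally_integrable_on Omega v -> locally_integrable_on Omega (fun x => u x + v x).
Proof.
move=> [mu' iu] [mv iv]; split; first exact: measurable_funD.
move=> K cK KO.
exact: (integrableD (compact_measurable_rV cK) (iu K cK KO) (iv K cK KO)).
Qed.

Lemma locally_integrableZ (k : R) u : locally_integrable_on Omega u ->
  locally_integrable_on Omega (fun x => k * u x).
Proof.
move=> [mu' iu]; split; first exact: measurable_funM.
move=> K cK KO; have mK := compact_measurable_rV cK.
have := integrableZl mK k (iu K cK KO).
by apply: eq_integrable => // x _ /=; rewrite EFinM.
Qed.

Lemma weak_derivativeD s u1 v1 u2 v2 : weak_derivative Omega s u1 v1 ->
  weak_derivative Omega s u2 v2 ->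
  weak_derivative Omega s (fun x => u1 x + u2 x) (fun x => v1 x + v2 x).
Proof.
move=> [lu1 lv1 w1] [lu2 lv2 w2]; split; [exact: locally_integrableD..|].
move=> phi tphi.
under eq_Rintegral do rewrite mulrDl.
under [in RHS]eq_Rintegral do rewrite mulrDl.
rewrite !RintegralD//; last 4 first.
- exact: (@integrable_mul_test v1 phi [::]).
- exact: (@integrable_mul_test v2 phi [::]).
- exact: integrable_mul_test.
- exact: integrable_mul_test.
by rewrite mulrDr w1// w2.
Qed.

Lemma weak_derivativeZ s (k : R) u v : weak_derivative Omega s u v ->
  weak_derivative Omega s (fun x => k * u x) (fun x => k * v x).
Proof.
move=> [lu lv w]; split; [exact: locally_integrableZ..|].
move=> phi tphi.
under eq_Rintegral do rewrite -mulrA.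
under [in RHS]eq_Rintegral do rewrite -mulrA.
rewrite !RintegralZl//; last 2 first.
- exact: (@integrable_mul_test v phi [::]).
- exact: integrable_mul_test.
by rewrite w// mulrCA.
Qed.

Let weak_norm s u :=
  ereal_inf [set L2norm mu Omega v | v in weak_derivative Omega s u].

Let weak_norm_ge0 s u : (0 <= weak_norm s u)%E.
Proof. by apply: le_ereal_inf_tmp => _ [v _ <-]; exact: Lnorm_ge0. Qed.

Lemma sobnorm_ge0 p u : (0 <= sobnorm Omega mu p u)%E.
Proof. by apply: sume_ge0 => a _; exact: weak_norm_ge0. Qed.

Lemma sobnormD p u v :
  (sobnorm Omega mu p (fun x => (u x + v x)%R) <=
   sobnorm Omega mu p u + sobnorm Omega mu p v)%E.
Proof.
rewrite /sobnorm -big_split /=; apply: lee_sum => a _.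
apply: ereal_inf_le_add.
- by move=> _ [w _ <-]; exact: Lnorm_ge0.
- by move=> _ [w _ <-]; exact: Lnorm_ge0.
move=> _ _ [v1 w1 <-] [v2 w2 <-].
exists (L2norm mu Omega (fun x => v1 x + v2 x)).
  by exists (fun x => v1 x + v2 x) => //; exact: weak_derivativeD.
by apply: L2normD => //; [case: w1 => _ []|case: w2 => _ []].
Qed.

Lemma sobnormZ p (k : R) u : k != 0 ->
  (sobnorm Omega mu p (fun x => (k * u x)%R) <=
   `|k|%:E * sobnorm Omega mu p u)%E.
Proof.
move=> k0; have nk0 : 0 < `|k| by rewrite normr_gt0.
rewrite /sobnorm ge0_sume_distrr; last by move=> a _; exact: weak_norm_ge0.
apply: lee_sum => a _; rewrite -lee_pdivrMl//.
apply: le_ereal_inf_tmp => _ [v wv <-].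
rewrite lee_pdivrMl// -L2normZ//; last by case: wv => _ [].
by apply: ereal_inf_lbound; exists (fun x => k * v x) => //; exact: weak_derivativeZ.
Qed.

(** The two sums range over different types of multi-indices; the injection [w2] keeps the list of
    derivatives and makes the first a partial sum of the second. *)
Lemma sobnorm1_le2 u : (sobnorm Omega mu 1 u <= sobnorm Omega mu 2 u)%E.
Proof.
pose w2 (a : {ffun 'I_n -> 'I_2}) : {ffun 'I_n -> 'I_3} :=
  [ffun i => widen_ord (leqnSn 2) (a i)].
have w2_inj : injective w2.
  move=> a b /ffunP ab; apply/ffunP => i; have := ab i.
  by rewrite !ffunE => /(congr1 val) /= /val_inj.
have w2_index a : multi_index (w2 a) = multi_index a.
  by congr flatten; apply: eq_map => i; rewrite ffunE.
rewrite /sobnorm.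
under eq_bigr do rewrite -w2_index.
rewrite -(big_imset (fun b : {ffun 'I_n -> 'I_3} => weak_norm (multi_index b) u));
  last by move=> a b _ _; exact: w2_inj.
apply: lee_sum_nneg_subset => [b /imsetP[a]|b _]; last exact: weak_norm_ge0.
rewrite !unfold_in /= => a1 ->.
by under eq_bigr do rewrite ffunE /=; exact: leq_trans a1 _.
Qed.

(** The zero function is a weak derivative of [u] along every multi-index, which brings each infimum
    down to zero. *)
Lemma sobnorm_ae0 p u : measurable_fun Omega u ->
  {ae lebesgue_rV n, forall x, Omega x -> u x = 0} ->
  sobnorm Omega mu p u = 0%E.
Proof.
move=> mu' u0; apply: big1 => a _; apply/eqP; rewrite eq_le weak_norm_ge0 andbT.
rewrite -(L2norm_cst0 mu Omega); apply: ereal_inf_lbound; exists (cst 0) => //.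
split.
- split=> // K cK KO; have mK := compact_measurable_rV cK.
  apply/integrableP; split.
    by apply/measurable_EFinP; exact: measurable_funS mu'.
  rewrite (ae_eq_integral (cst 0%E)) ?integral0//.
    apply: measurableT_comp => //; apply/measurable_EFinP.
    exact: measurable_funS mu'.
  by apply: filterS u0 => x ux /KO Kx /=; rewrite ux// normr0.
- split; first exact: measurable_cst.
  by move=> K cK KO; apply: integrable0; exact: compact_measurable_rV.
- move=> phi tphi.
  have -> : \int[lebesgue_rV n]_(x in Omega) (cst 0 x * phi x) = 0.
    by under eq_Rintegral do rewrite mul0r; rewrite /Rintegral integral0.
  rewrite mulr0 /Rintegral (ae_eq_integral (cst 0%E)) ?integral0//.
    apply/measurable_EFinP; apply: measurable_funM => //.
    apply: measurable_funS measurableT _ _ => //.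
    by apply: continuous_measurable_rV => x; exact: (test_partials_continuous tphi).
  by apply: filterS u0 => x ux Ox /=; rewrite ux// mul0r.
Qed.

End sobolev_theory.

(** * Traces along the flow *)

Lemma cvge0_near_lt (R : realType) (T : Type) (F : set_system T) (f : T -> \bar R)
  (e : R) : f @ F --> 0%E -> 0 < e -> F (fun t => (f t < e%:E)%E).
Proof.
move=> fF e0; have := @open_ereal_lt' _ 0%E e%:E; rewrite lte_fin => /(_ e0).
exact: fF.
Qed.

Lemma is_derive_0 (R : realType) (phi : R -> R) (t : R) :
  (forall e, 0 < e -> exists2 r, 0 < r &
     forall h, `|h| < r -> `|phi (t + h) - phi t| <= e * `|h|) ->
  is_derive t (1 : R) phi 0.
Proof.
move=> small.
have cphi : h^-1 *: ((phi \o shift t) (h *: (1 : R)) - phi t) @[h --> 0^'] --> (0 : R).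
  apply/cvgr0Pnorm_le => e e0; have [r r0 hr] := small e e0.
  near=> h; have h0 : h != 0 by near: h; exact: nbhs_dnbhs_neq.
  rewrite /= [h *: (1 : R)]mulr1 [h + t]addrC normrZ normfV mulrC.
  rewrite ler_pdivrMr ?normr_gt0//; apply: hr; near: h.
  exact: dnbhs0_lt.
split; first by apply/cvg_ex; exists 0.
exact/cvg_lim.
Unshelve. all: by end_near. Qed.

Section trace.
Context (R : realType) (n : nat) (Omega : set 'rV[R]_n).
Context (mu : {measure set 'rV[R]_n -> \bar R}).
Hypotheses (oO : open Omega) (dmu : continuous_density Omega mu).
Implicit Types (u v z f g : 'rV[R]_n -> R).

Definition vanishing z :=
  Ck setT 1 z /\ forall x, boundary Omega x -> z x = 0.

(** Its zeros are the H^1 limits of C^1 functions vanishing on the boundary, that is, a concrete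
    substitute for the kernel of the trace. *)
Definition vanishing_dist u : \bar R :=
  ereal_inf [set sobnorm Omega mu 1 (fun x => u x - z x) | z in vanishing].

Lemma vanishingZ (k : R) z : vanishing z -> vanishing (fun x => k * z x).
Proof.
move=> [zC z0]; split; first exact: Ck1Z.
by move=> x /z0 ->; rewrite mulr0.
Qed.

Lemma vanishingD z z' : vanishing z -> vanishing z' ->
  vanishing (fun x => z x + z' x).
Proof.
move=> [zC z0] [zC' z0']; split; first exact: Ck1D.
by move=> x bx; rewrite z0// z0'// addr0.
Qed.

Lemma vanishing0 : vanishing (cst 0).
Proof. by split=> //; exact: Ck1_cst. Qed.

Lemma vanishing_dist_ge0 u : (0 <= vanishing_dist u)%E.
Proof. by apply: le_ereal_inf_tmp => _ [z _ <-]; exact: sobnorm_ge0. Qed.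

(** Vanishing functions are stable under sums, so the distance only feels the part of an increment
    [v] that a vanishing [z] does not account for. *)
Lemma vanishing_distD u v z : vanishing z ->
  (vanishing_dist (fun x => (u x + v x)%R) <=
   vanishing_dist u + sobnorm Omega mu 1 (fun x => (v x - z x)%R))%E.
Proof.
move=> vz; rewrite -[X in (_ + X)%E]ereal_inf1; apply: ereal_inf_le_add.
- by move=> _ [w _ <-]; exact: sobnorm_ge0.
- by move=> _ ->; exact: sobnorm_ge0.
move=> _ _ [z' vz' <-] ->.
exists (sobnorm Omega mu 1 (fun x => u x + v x - (z' x + z x))).
  by exists (fun x => z' x + z x) => //; exact: vanishingD.
have -> : (fun x => u x + v x - (z' x + z x)) =
    (fun x => (u x - z' x) + (v x - z x)) by apply/funext => x; ring.
exact: sobnormD.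
Qed.

Variables (B L : ('rV[R]_n -> R) -> 'rV[R]_n -> R) (alpha : R).
Hypothesis BL : forall u, sobolev Omega mu 2 u -> vanishing (B (L u)).

Lemma wide_network_limit_vanishing f (Q : R -> 'rV[R]_n -> R) :
  sobolev Omega mu 2 f -> wide_network_limit Omega mu B L alpha f Q ->
  forall t, 0 <= t -> vanishing_dist (fun x => Q t x - f x) = 0%E.
Proof.
move=> sf [sQ Q0f dQ].
pose dist t := vanishing_dist (fun x => Q t x - f x).
have fin t : 0 <= t -> dist t \is a fin_num.
  move=> t0; rewrite ge0_fin_numE ?vanishing_dist_ge0//.
  apply: (@le_lt_trans _ _ (sobnorm Omega mu 1 (fun x => Q t x - f x - cst 0 x))).
    by apply: ereal_inf_lbound; exists (cst 0) => //; exact: vanishing0.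
  rewrite (_ : (fun x => _) = (fun x => Q t x + (-1) * f x)); last first.
    by apply/funext => x; rewrite subr0 mulN1r.
  apply: (le_lt_trans (sobnormD mu oO 1 _ _)); apply: lte_add_pinfty.
    by apply: (le_lt_trans (sobnorm1_le2 _ _ _)); have [] := sQ t t0.
  apply: (le_lt_trans (sobnormZ mu oO 1 _ _)); first by rewrite oppr_eq0 oner_eq0.
  rewrite lte_mul_pinfty//.
  by apply: (le_lt_trans (sobnorm1_le2 _ _ _)); case: sf.
(* From a to b, Q moves by (b - a) alpha B(L Q_a), which is vanishing, plus an error of norm below
   [e * |b - a|]. *)
have step a b e : 0 <= a -> 0 <= b -> b != a ->
    (sobnorm Omega mu 2 (fun x => ((b - a)^-1 * (Q (a + (b - a)) x - Q a x)
      - alpha * B (L (Q a)) x)%R) < e%:E)%E ->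
    `|fine (dist b) - fine (dist a)| <= e * `|b - a|.
  move=> a0 b0 ba hE; have k0 : b - a != 0 by rewrite subr_eq0.
  have vz : vanishing (fun x => (b - a) * (alpha * B (L (Q a)) x)).
    by do 2 apply: vanishingZ; apply: BL; exact: sQ.
  have vz' : vanishing (fun x => - (b - a) * (alpha * B (L (Q a)) x)).
    by do 2 apply: vanishingZ; apply: BL; exact: sQ.
  have small (k : R) : k != 0 -> `|k| = `|b - a| ->
      (sobnorm Omega mu 1 (fun x => (k * ((b - a)^-1 * (Q (a + (b - a)) x - Q a x)
      - alpha * B (L (Q a)) x))%R) <= (e * `|b - a|)%:E)%E.
    move=> kn0 kE; apply: (le_trans (sobnormZ mu oO 1 _ kn0)).
    rewrite kE mulrC EFinM lee_wpmul2l// ltW//.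
    exact: le_lt_trans (sobnorm1_le2 _ _ _) hE.
  have up : (dist b <= dist a + (e * `|b - a|)%:E)%E.
    have := @vanishing_distD (fun x => Q a x - f x) (fun x => Q b x - Q a x) _ vz.
    rewrite (_ : (fun x => (_ + _)%R) = (fun x => Q b x - f x)); last first.
      by apply/funext => x; ring.
    move/le_trans; apply; rewrite leeD2l//.
    rewrite (_ : (fun x => _) = (fun x => (b - a) *
      ((b - a)^-1 * (Q (a + (b - a)) x - Q a x) - alpha * B (L (Q a)) x))).
      exact: small.
    by apply/funext => x; rewrite subrKC; field.
  (* The reverse increment is still expanded at a, the only time where the error is controlled;
     hence the sign in [vz']. *)
  have down : (dist a <= dist b + (e * `|b - a|)%:E)%E.
    have := @vanishing_distD (fun x => Q b x - f x) (fun x => Q a x - Q b x) _ vz'.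
    rewrite (_ : (fun x => (_ + _)%R) = (fun x => Q a x - f x)); last first.
      by apply/funext => x; ring.
    move/le_trans; apply; rewrite leeD2l//.
    rewrite (_ : (fun x => _) = (fun x => (- (b - a)) *
      ((b - a)^-1 * (Q (a + (b - a)) x - Q a x) - alpha * B (L (Q a)) x))).
      by apply: small; rewrite ?oppr_eq0// normrN.
    by apply/funext => x; rewrite subrKC; field.
  move: up down; rewrite -[dist a]fineK ?fin// -[dist b]fineK ?fin//.
  rewrite -!EFinD !lee_fin => up down.
  by rewrite ler_norml lerBrDr lerBlDl up andbT addrC lerBlDr.
(* Freezing the distance for t < 0 turns the one-sided derivative at 0 into a two-sided one, so that
   the criterion for constancy applies on the whole line. *)
pose phi t := fine (dist (Num.max t 0)).
have max0 (t : R) : 0 <= Num.max t 0 by rewrite le_max lexx orbT.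
have dphi (t : R) : is_derive t (1 : R) phi 0.
  apply: is_derive_0 => e e0; pose a := Num.max t 0.
  have := cvge0_near_lt (dQ a (max0 t)) e0.
  rewrite /within /= /dnbhs /within => /nbhs_ballP[r /= r0 hr].
  exists r => // h hlt; rewrite /phi -/a; set b := Num.max (t + h) 0.
  (* Truncation at 0 is 1-Lipschitz, so an increment h of t gives no larger increment of the
     truncated time. *)
  have bah : `|b - a| <= `|h|.
    rewrite /b /a; case: (leP (t + h) 0) => th; case: (leP t 0) => t0.
    + by rewrite subrr normr0.
    + rewrite sub0r normrN gtr0_norm// -normrN (le_trans _ (ler_norm _))//; lra.
    + rewrite subr0 gtr0_norm// (le_trans _ (ler_norm _))//; lra.
    + by rewrite addrC addKr.
  have [->|ba] := eqVneq b a; first by rewrite subrr normr0 mulr_ge0// ltW.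
  apply: (@le_trans _ _ (e * `|b - a|)); last by rewrite ler_wpM2l// ltW.
  apply: step => //; [exact: max0..|].
  apply: hr => /=.
  - by rewrite /ball /= sub0r normrN (le_lt_trans bah).
  - by rewrite subr_eq0.
  - by rewrite subrKC; exact: max0.
move=> t t0; have : phi t = phi 0 by exact: is_derive_0_is_cst.
rewrite /phi maxxx (max_idPl t0).
suff d0 : dist 0 = 0%E.
  by rewrite d0 /= => e; rewrite -/(dist t) -[dist t]fineK ?fin// e.
apply/eqP; rewrite eq_le vanishing_dist_ge0 andbT.
have s0 : sobnorm Omega mu 1 (fun x => Q 0 x - f x - cst 0 x) = 0%E.
  apply: sobnorm_ae0 => //.
    apply: measurable_funB => //; apply: measurable_funB.
      by have [[]] := sQ 0 (lexx _).
    by have [[]] := sf.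
  apply: (density_negligible oO dmu (P := fun x => Q 0 x - f x - cst 0 x = 0)).
  by apply: filterS Q0f => x /= + Ox => ->//; rewrite !subr0 subrr.
by rewrite -s0; apply: ereal_inf_lbound; exists (cst 0) => //; exact: vanishing0.
Qed.

(** If v_k approximates f and a vanishing z_k approximates [Qinf] - f in H^1, then v_k + z_k
    approximates [Qinf] and has exactly the boundary values of v_k. No trace inequality enters. *)
Lemma wide_network_limit_trace f g (Q : R -> 'rV[R]_n -> R) Qinf :
  sobolev Omega mu 2 f -> has_trace Omega mu f g ->
  wide_network_limit Omega mu B L alpha f Q ->
  sobnorm Omega mu 1 (fun x => Q t x - Qinf x) @[t --> +oo] --> 0%E ->
  has_trace Omega mu Qinf g.
Proof.
move=> sf [L2g [v [vC vf vg]]] Qlim Qinfty; split=> //.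
have approx k : exists z, vanishing z /\
    (sobnorm Omega mu 1 (fun x => (f x + z x - Qinf x)%R) <= k.+1%:R^-1%:E)%E.
  (* One half of the error is for replacing [Qinf] by Q_t, the other for replacing Q_t - f by a
     vanishing function. *)
  have k2 : 0 < (k.+1%:R^-1 : R) / 2 by rewrite divr_gt0.
  have [t [t0 tQ]] : exists t, 0 <= t /\
      (sobnorm Omega mu 1 (fun x => (Q t x - Qinf x)%R) < (k.+1%:R^-1 / 2)%:E)%E.
    near (@pinfty_nbhs R) => t; exists t; split; near: t.
      exact: nbhs_pinfty_ge.
    exact: cvge0_near_lt Qinfty k2.
  have d0 := wide_network_limit_vanishing sf Qlim t0.
  have [|_ [z vz <-]] := @lb_ereal_inf_adherent R
      [set sobnorm Omega mu 1 (fun x => Q t x - f x - z x) | z in vanishing] _ k2.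
    by rewrite -/(vanishing_dist _) d0.
  rewrite -/(vanishing_dist _) d0 add0e => hz.
  exists z; split=> //.
  rewrite (_ : (fun x => _) = (fun x => (-1) * (Q t x - f x - z x) + (Q t x - Qinf x)));
    last by apply/funext => x; ring.
  apply: (le_trans (sobnormD mu oO 1 _ _)).
  rewrite [leRHS](_ : _ = ((k.+1%:R^-1 / 2)%:E + (k.+1%:R^-1 / 2)%:E)%E).
    apply: leeD; last exact: ltW.
    apply: (le_trans (sobnormZ mu oO 1 _ _)); first by rewrite oppr_eq0 oner_eq0.
    by rewrite normrN normr1 mul1e ltW.
  by rewrite -EFinD -splitr.
have /choice[z hz] := approx.
exists (fun k x => v k x + z k x); split.
- by move=> k; apply: Ck1D => //; have [[]] := hz k.
- apply: (@squeeze_cvge _ _ _ _ (cst 0%E) _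
    (fun k => sobnorm Omega mu 1 (fun x => (v k x - f x)%R) + k.+1%:R^-1%:E)%E).
  + apply: nearW => k; rewrite sobnorm_ge0 /=.
    rewrite (_ : (fun x => _) = (fun x => (v k x - f x) + (f x + z k x - Qinf x)));
      last by apply/funext => x; ring.
    apply: (le_trans (sobnormD mu oO 1 _ _)).
    by rewrite leeD2l//; have [] := hz k.
  + exact: cvg_cst.
  + rewrite -[X in _ --> X](adde0 0%E); apply: cvgeD => //.
    exact: cvge_harmonic.
- rewrite (_ : (fun k => _) = (fun k => L2norm (surface_measure R n) (boundary Omega)
    (fun x => v k x - g x)))//.
  apply/funext => k; apply: L2norm_eq => x bx.
  by have [[_ ->//]] := hz k; rewrite addr0.
Unshelve. all: by end_near. Qed.

End trace.

(** * Random feature kernels *)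

Lemma Rintegral_sum d (T : measurableType d) (R : realType)
    (m : {measure set T -> \bar R}) (I : Type) (r : seq I) (F : I -> T -> R) :
  (forall i, m.-integrable setT (EFin \o F i)) ->
  m.-integrable setT (EFin \o (fun t => \sum_(i <- r) F i t)) /\
  \int[m]_t (\sum_(i <- r) F i t) = \sum_(i <- r) \int[m]_t F i t.
Proof.
move=> iF; elim: r => [|i r [IHi IH]].
  under [in X in X /\ _]eq_fun do rewrite big_nil.
  under eq_Rintegral do rewrite big_nil.
  rewrite big_nil /Rintegral integral0; split=> //.
  exact: (@integrable0 _ _ _ m setT).
under [in X in X /\ _]eq_fun do rewrite big_cons.
under eq_Rintegral do rewrite big_cons.
by rewrite big_cons RintegralD// IH; split=> //; exact: integrable_add.
Qed.

Section fubini_bounded.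
Context d1 (T1 : measurableType d1) d2 (T2 : measurableType d2) (R : realType).
Context (m : {finite_measure set T1 -> \bar R}) (P : probability T2 R).
Variables (h : T1 -> R) (psi : T1 * T2 -> R) (K : R).
Hypotheses (mpsi : measurable_fun setT psi).
Hypothesis ih : m.-integrable setT (EFin \o h).
Hypothesis hK : forall x t, `|h x * psi (x, t)| <= K * `|h x|.

Let F (z : T1 * T2) := (h z.1 * psi z)%:E.

Let iF : (m \x P)%E.-integrable setT F.
Proof.
have mF : measurable_fun setT F.
  apply/measurable_EFinP; apply: measurable_funM => //.
  exact: measurableT_comp (integrable_measurable ih) measurable_fst.
apply/(integrable12ltyP m P mF).
have iK := integrable_scale K (integrable_norm ih).
apply: (@le_lt_trans _ _ (\int[m]_x `|(K * `|h x|)%:E|)%E); last first.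
  by case/integrableP : iK.
apply: ge0_le_integral => //.
- by move=> x _; exact: integral_ge0.
- apply: (measurable_fun_fubini_tonelli_F (m2 := P) (abse \o F)) => //=.
  exact: measurableT_comp.
- by apply: measurableT_comp => //; case/integrableP : iK.
move=> x _.
apply: (@le_trans _ _ (\int[P]_t (K * `|h x|)%:E)%E).
  apply: ge0_le_integral => //.
  - apply: measurableT_comp => //; apply: measurableT_comp mF _.
    exact: measurable_pair1.
  - by move=> t _; rewrite lee_fin; exact: hK.
rewrite integral_cst//.
rewrite [X in (_ * X)%E](_ : _ = 1%E); last exact: (probability_setT P).
by rewrite mule1 lee_fin ler_norm.
Qed.

Let psix x : h x != 0 -> P.-integrable setT (EFin \o (fun t => psi (x, t))).
Proof.
move=> hx; have h0 : 0 < `|h x| by rewrite normr_gt0.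
apply: (@dominated_integrable_fun _ _ _ P (cst K)).
- by apply: measurableT_comp mpsi _; exact: measurable_pair1.
- exact: finite_measure_integrable_cst.
- move=> t; have := hK x t; rewrite normrM mulrC ler_pM2r// => /le_trans; apply.
  exact: ler_norm.
Qed.

(** Where [h x = 0] nothing bounds [psi (x, .)], which may fail to be integrable; both sides are
    then zero. *)
Let inner x : (\int[P]_t F (x, t))%E = (h x * \int[P]_t psi (x, t))%:E.
Proof.
rewrite /F /=; have [->|hx] := eqVneq (h x) 0.
  by rewrite mul0r; under eq_integral do rewrite mul0r; rewrite integral0.
rewrite -[LHS]fineK.
  congr EFin; exact: (RintegralZl (h x) measurableT (psix hx)).
apply: integrable_fin_num => //.
by apply: integrable_scale; exact: psix.
Qed.

Lemma integrable_Rintegral_bounded :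
  m.-integrable setT (EFin \o (fun x => h x * \int[P]_t psi (x, t))).
Proof.
have := integrable_fubini_F iF.
by apply: eq_integrable => // x _; rewrite /= -inner.
Qed.

Lemma Rintegral_Fubini_bounded :
  \int[m]_x (h x * \int[P]_t psi (x, t)) = \int[P]_t \int[m]_x (h x * psi (x, t)).
Proof.
transitivity (fine (\int[m]_x \int[P]_t F (x, t))%E).
  by rewrite /Rintegral; congr fine; apply: eq_integral => x _; rewrite inner.
rewrite (Fubini iF) /Rintegral; congr fine; apply: eq_integral => t _.
rewrite fineK//; apply: integrable_fin_num => //.
apply: (@integrable_bounded_mul _ _ _ _ K) => //.
by apply: measurableT_comp mpsi _; exact: measurable_pair2.
Qed.

Lemma measurable_Rintegral_bounded :
  measurable_fun setT (fun t => \int[m]_x (h x * psi (x, t))).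
Proof.
have := measurable_fubini_G iF.
exact: (measurableT_comp (@fine_measurable R setT measurableT)).
Qed.

End fubini_bounded.

(** * Expectations of ridge functions *)

Section ridge.
Context d (T : measurableType d) (R : realType) (m : {measure set T -> \bar R}).
Variables (M : R) (G g : R -> R).
Hypothesis cG : C11 M G g.

Lemma C11_bounded_mul (Z u : T -> R) : m.-integrable setT (EFin \o Z) ->
  measurable_fun setT u -> m.-integrable setT (EFin \o (fun t => Z t * G (u t))).
Proof.
move=> iZ mu; apply: (@integrable_bounded_mul _ _ _ _ M) => //.
  exact: measurableT_comp (C11_measurable cG) mu.
by move=> t; rewrite normrM mulrC ler_wpM2r//; case: cG.
Qed.

(** [F] is separate from [G] so as to serve for both [G] and its derivative [g], which share the
    Lipschitz constant [M]. *)
Lemma Rintegral_lipschitz (F : R -> R) (Z u v D : T -> R) :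
  (forall x y, `|F x - F y| <= M * `|x - y|) ->
  m.-integrable setT (EFin \o (fun t => Z t * F (u t))) ->
  m.-integrable setT (EFin \o (fun t => Z t * F (v t))) ->
  m.-integrable setT (EFin \o D) ->
  (forall t, `|Z t * (u t - v t)| <= D t) ->
  `|\int[m]_t (Z t * F (u t)) - \int[m]_t (Z t * F (v t))| <= M * \int[m]_t D t.
Proof.
move=> lF iu iv iD ZD; rewrite -RintegralB// -RintegralZl//.
apply: le_norm_Rintegral.
- by apply: (@integrable_measurable _ _ _ m); exact: integrable_sub.
- exact: integrable_scale.
move=> t; rewrite -mulrBr normrM.
apply: (le_trans (ler_wpM2l (normr_ge0 _) (lF _ _))).
by rewrite mulrCA -normrM ler_wpM2l//; exact: (C11_ge0 cG).
Qed.

End ridge.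

Lemma C11_integrable_derive d (T : measurableType d) (R : realType)
    (m : {measure set T -> \bar R}) M (G g : R -> R) (Z u : T -> R) :
  C11 M G g -> m.-integrable setT (EFin \o Z) ->
  measurable_fun setT u -> m.-integrable setT (EFin \o (fun t => Z t * g (u t))).
Proof.
move=> cG iZ mu; apply: (@integrable_bounded_mul _ _ _ _ M) => //.
  exact: measurableT_comp (C11_derive_measurable cG) mu.
by move=> t; rewrite normrM mulrC ler_wpM2r//; case: cG.
Qed.

Lemma norm_dotv_le (R : realType) n (w y : 'rV[R]_n) :
  `|dotv w y| <= (\sum_j `|w 0 j|) * `|y|.
Proof.
rewrite /dotv (le_trans (ler_norm_sum _ _ _))// mulr_suml ler_sum// => j _.
by rewrite normrM ler_wpM2l// coord_le_norm.
Qed.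

Lemma rV_lipschitz_continuous (R : realType) n (F : 'rV[R]_n -> R) (C : R) :
  (forall y z, `|F y - F z| <= C * `|y - z|) -> continuous F.
Proof.
move=> lF x; apply/(@cvgrPdist_lt _ _ _ (nbhs x)) => e e0.
have C1 : 0 < `|C| + 1 by rewrite ltr_wpDl.
have r0 : 0 < e / (`|C| + 1) by rewrite divr_gt0.
apply/nbhs_ballP; exists (e / (`|C| + 1)) => // y; rewrite -ball_normE /= => xy.
rewrite (le_lt_trans (lF _ _))//.
apply: (@le_lt_trans _ _ ((`|C| + 1) * `|x - y|)).
  by rewrite ler_wpM2r// ler_wpDr// ler_norm.
by rewrite mulrC -ltr_pdivlMr.
Qed.

Lemma is_derive_line (R : realType) n (F : 'rV[R]_n -> R) (phi : R -> R)
    (y v : 'rV[R]_n) (l : R) : (forall h, F (h *: v + y) = phi h) ->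
  is_derive (0 : R) (1 : R) phi l -> is_derive y v F l.
Proof.
move=> Fphi dphi.
have E : (fun h : R => h^-1 *: ((F \o shift y) (h *: v) - F y)) =
    (fun h : R => h^-1 *: ((phi \o shift 0) (h *: (1 : R)) - phi 0)).
  apply/funext => h /=; rewrite Fphi addr0 [h *: (1 : R)]mulr1.
  by rewrite -(Fphi 0) scale0r add0r.
by case: dphi => dphi <-; split; rewrite /derivable /derive E.
Qed.

Section ridge_Ck1.
Context d (T : measurableType d) (R : realType) (P : {measure set T -> \bar R}).
Context (n : nat) (w : T -> 'rV[R]_n) (b : T -> R).
Hypotheses (mw : measurable_fun setT w) (mb : measurable_fun setT b).
Variables (M : R) (G g : R -> R).
Hypothesis cG : C11 M G g.
Variable Z : T -> R.
Hypothesis iZ : P.-integrable setT (EFin \o Z).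
Hypothesis iZw : forall i, P.-integrable setT (EFin \o (fun t => Z t * w t 0 i)).
Hypothesis iZww : forall i j,
  P.-integrable setT (EFin \o (fun t => Z t * w t 0 i * w t 0 j)).

Let mwi i : measurable_fun setT (fun t => w t 0 i).
Proof. exact: measurableT_comp (measurable_coord_rV i) mw. Qed.

Let mu y : measurable_fun setT (fun t => dotv (w t) y + b t).
Proof. by apply: measurable_funD => //; exact: measurable_dotv. Qed.

Let ridge_lipschitz (F : R -> R) (Z' : T -> R) :
  (forall x y, `|F x - F y| <= M * `|x - y|) ->
  (forall y, P.-integrable setT (EFin \o (fun t => Z' t * F (dotv (w t) y + b t)))) ->
  (forall i, P.-integrable setT (EFin \o (fun t => Z' t * w t 0 i))) ->
  continuous (fun y => \int[P]_t (Z' t * F (dotv (w t) y + b t))).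
Proof.
move=> lF iF iZ'.
have [iS _] := Rintegral_sum (enum 'I_n) (fun j => integrable_norm (iZ' j)).
apply: (@rV_lipschitz_continuous _ _ _
  (M * \int[P]_t (\sum_(j <- enum 'I_n) `|Z' t * w t 0 j|))) => y z.
rewrite -mulrA -RintegralZr//.
apply: (Rintegral_lipschitz cG lF (iF y) (iF z)).
  by under eq_fun do rewrite mulrC; exact: integrable_scale.
move=> t; rewrite opprD addrACA subrr addr0.
have -> : dotv (w t) y - dotv (w t) z = dotv (w t) (y - z).
  by rewrite !(dotvC (w t)) dotvDl -[- z]scaleN1r dotvZl mulN1r.
rewrite normrM (le_trans (ler_wpM2l _ (norm_dotv_le _ _)))//.
rewrite mulrA ler_wpM2r// mulr_sumr big_enum /=.
by apply: ler_sum => j _; rewrite normrM.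
Qed.

(** Differentiation in y_i brings down a factor w_i; the Taylor error and the Lipschitz bound on the
    derivative each bring a second one. This is where second moments of w enter. *)
Lemma ridge_Ck1 : Ck setT 1 (fun y => \int[P]_t (Z t * G (dotv (w t) y + b t))).
Proof.
have iG y : P.-integrable setT (EFin \o (fun t => Z t * G (dotv (w t) y + b t))).
  exact: (C11_bounded_mul cG iZ (mu y)).
have ig i y : P.-integrable setT
    (EFin \o (fun t => Z t * w t 0 i * g (dotv (w t) y + b t))).
  exact: (C11_integrable_derive cG (iZw i) (mu y)).
have D i y : is_derive y (delta_mx 0 i : 'rV[R]_n)
    (fun y => \int[P]_t (Z t * G (dotv (w t) y + b t)))
    (\int[P]_t (Z t * w t 0 i * g (dotv (w t) y + b t))).
  apply: is_derive_line (is_derive_under_integral cG (mu y) (mwi i) iZ (iZw i) _).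
    move=> h; apply: eq_Rintegral => t _; congr (_ * G _).
    rewrite !(dotvC (w t)) dotvDl dotvZl dotv_delta; ring.
  by under eq_fun do rewrite expr2 mulrA; exact: iZww.
apply/Ck1P; split.
- apply: ridge_lipschitz => //; exact: C11_lipschitz cG.
- by move=> i y; case: (D i y).
- move=> i; rewrite (_ : partial i _ =
      fun y => \int[P]_t (Z t * w t 0 i * g (dotv (w t) y + b t))).
    by apply: ridge_lipschitz => //; case: cG.
  by apply/funext => y; case: (D i y).
Qed.

End ridge_Ck1.

Section finite_copy.
Context d (T : measurableType d) (R : realType) (mu : {measure set T -> \bar R}).

(** A named copy of [mu] indexed by the proof of finiteness, to which the structure of a finite
    measure can be attached. *)
Definition finite_copy (_ : fin_num_fun mu) : set T -> \bar R := mu.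

Variable fmu : fin_num_fun mu.
HB.instance Definition _ := Measure.on (finite_copy fmu).
HB.instance Definition _ :=
  @Measure_isFinite.Build _ _ _ (finite_copy fmu) fmu.

End finite_copy.

Lemma finite_measure_pack d (T : measurableType d) (R : realType)
    (mu : {measure set T -> \bar R}) : (mu setT < +oo)%E ->
  exists nu : {finite_measure set T -> \bar R}, (nu : {measure set T -> \bar R}) = mu.
Proof.
move=> mu_fin.
have fmu : fin_num_fun mu.
  move=> A mA; rewrite ge0_fin_numE//; apply: le_lt_trans mu_fin.
  by apply: le_measure; rewrite ?inE.
by exists (finite_copy fmu); apply: eq_measure.
Qed.

Section random_features.
Context d (T : measurableType d) (R : realType) (P : probability T R).
Context (n : nat) (w : T -> 'rV[R]_n) (b : T -> R).
Hypotheses (mw : measurable_fun setT w) (mb : measurable_fun setT b).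
Hypothesis iw : forall i, P.-integrable setT (EFin \o (fun t => w t 0 i)).
Hypothesis iww : forall i j,
  P.-integrable setT (EFin \o (fun t => w t 0 i * w t 0 j)).
Context (mu : {finite_measure set 'rV[R]_n -> \bar R}) (Omega : set 'rV[R]_n).
Context (I : Type) (r : seq I) (M : R).
Variables (a : I -> T -> R) (tau tau' : I -> R -> R) (p : I -> 'rV[R]_n -> R).
Hypothesis ma : forall k, measurable_fun setT (a k).
Hypothesis aM : forall k t, `|a k t| <= M.
Hypothesis ctau : forall k, C11 M (tau k) (tau' k).
Hypothesis pC : forall k, Ck setT 1 (p k).
Hypothesis pM : forall k x, Omega x -> `|p k x| <= M.

Definition feature k (x : 'rV[R]_n) (t : T) : R :=
  a k t * tau k (dotv (w t) x + b t) * p k x.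

Definition feature_coef (h : 'rV[R]_n -> R) k (t : T) : R :=
  \int[mu]_x (h x * feature k x t).

Let M0 (k : I) : 0 <= M. Proof. exact: C11_ge0 (ctau k). Qed.

Let mp k : measurable_fun setT (p k).
Proof. by apply: continuous_measurable_rV; have /Ck1P[] := pC k. Qed.

Let mtau k : measurable_fun setT (tau k). Proof. exact: C11_measurable (ctau k). Qed.

Lemma measurable_feature k :
  measurable_fun setT (fun z : 'rV[R]_n * T => feature k z.1 z.2).
Proof.
apply: measurable_funM; last exact: measurableT_comp (mp k) measurable_fst.
apply: measurable_funM; first exact: measurableT_comp (ma k) measurable_snd.
apply: measurableT_comp (mtau k) _; apply: measurable_funD.
  apply: measurable_dotv measurable_fst.
  exact: measurableT_comp mw measurable_snd.
exact: measurableT_comp mb measurable_snd.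
Qed.

Lemma measurable_feature2 k x : measurable_fun setT (feature k x).
Proof. exact: measurableT_comp (measurable_feature k) (measurable_pair1 x). Qed.

Lemma feature_le k x t : `|feature k x t| <= M * M * `|p k x|.
Proof.
rewrite normrM ler_wpM2r// normrM ler_pM//.
by have [+ _ _ _] := ctau k; apply.
Qed.

Variable h : 'rV[R]_n -> R.
Hypothesis sh : supported_integrable mu Omega h.

Let K := M * M * M.

Let h_feature_le k x t : `|h x * feature k x t| <= K * `|h x|.
Proof.
have [Ox|nOx] := pselect (Omega x); last by rewrite (sh.2 _ nOx) mul0r normr0 mulr0.
rewrite normrM mulrC ler_wpM2r// (le_trans (feature_le _ _ _))//.
by rewrite ler_wpM2l ?mulr_ge0 ?(M0 k)// pM.
Qed.

Let ihf k t : mu.-integrable setT (EFin \o (fun x => h x * feature k x t)).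
Proof.
apply: (@integrable_bounded_mul _ _ _ _ K).
- exact: measurableT_comp (measurable_feature k) (measurable_pair2 t).
- exact: sh.1.
- by move=> x; exact: h_feature_le.
Qed.

Let N := \int[mu]_x `|h x|.

Let coef_le k t : `|feature_coef h k t| <= K * N.
Proof.
rewrite /N -RintegralZl//; last exact: (integrable_norm sh.1).
apply: le_norm_Rintegral => //.
  by have /integrable_measurable := ihf k t.
apply: integrable_scale; exact: (integrable_norm sh.1).
Qed.

Let mcoef k : measurable_fun setT (feature_coef h k).
Proof.
exact: (@measurable_Rintegral_bounded _ _ _ _ _ mu P h _ K (measurable_feature k) sh.1).
Qed.

Lemma measurable_feature_coef k : measurable_fun setT (feature_coef h k).
Proof. exact: mcoef. Qed.

Definition feature_transform (y : 'rV[R]_n) : R :=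
  \sum_(k <- r) \int[P]_t (feature_coef h k t * feature k y t).

Let icoefa k : P.-integrable setT (EFin \o (fun t => feature_coef h k t * a k t)).
Proof.
apply: (@dominated_integrable_fun _ _ _ P (cst (K * N * M))).
- exact: measurable_funM.
- exact: finite_measure_integrable_cst.
- move=> t; rewrite normrM (le_trans _ (ler_norm _))// ler_pM//.
Qed.

(** In each term [p k] comes out of the expectation. What remains is a ridge expectation whose
    weight, coefficient times [a k], is bounded, so that the moments of w alone ensure
    integrability. *)
Lemma feature_transform_Ck1 : Ck setT 1 feature_transform.
Proof.
rewrite (_ : feature_transform = fun y => \sum_(k <- r) p k y *
    \int[P]_t (feature_coef h k t * a k t * tau k (dotv (w t) y + b t))).
  apply: Ck1_sum => k; apply: Ck1M => //.
  have bnd (Z : T -> R) : P.-integrable setT (EFin \o Z) ->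
      P.-integrable setT (EFin \o (fun t => feature_coef h k t * a k t * Z t)).
    move=> iZ; apply: (@dominated_integrable_fun _ _ _ P (fun t => K * N * M * Z t)).
    - by apply: measurable_funM; [exact: measurable_funM|exact: integrable_measurable iZ].
    - exact: integrable_scale.
    - move=> t; rewrite [leLHS]normrM [leRHS]normrM ler_wpM2r//.
      by rewrite (le_trans _ (ler_norm _))// normrM ler_pM.
  apply: (ridge_Ck1 mw mb (ctau k)) => //.
  - by move=> i; exact: bnd.
  - by move=> i j; under eq_fun do rewrite -mulrA; exact: bnd.
apply/funext => y; apply: eq_bigr => k _.
rewrite mulrC -RintegralZr//; last first.
  apply: (C11_bounded_mul (ctau k)) => //.
  by apply: measurable_funD => //; exact: measurable_dotv.
by apply: eq_Rintegral => t _; rewrite /feature !mulrA.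
Qed.

Let sum_feature_le (F : I -> R) (C : I -> R) x t :
  (forall k, `|F k| <= C k) ->
  `|h x * \sum_(k <- r) feature k x t * F k| <= (\sum_(k <- r) K * C k) * `|h x|.
Proof.
move=> FC; rewrite mulr_sumr (le_trans (ler_norm_sum _ _ _))// mulr_suml.
apply: ler_sum => k _; rewrite mulrA normrM [leRHS]mulrAC ler_pM//.
Qed.

Let inner_sum (F : I -> R) t :
  \int[mu]_x (h x * \sum_(k <- r) feature k x t * F k) =
  \sum_(k <- r) feature_coef h k t * F k.
Proof.
under eq_Rintegral do rewrite mulr_sumr.
have iF k : mu.-integrable setT (EFin \o (fun x => h x * (feature k x t * F k))).
  rewrite (_ : (fun x => _) = fun x => F k * (h x * feature k x t)).
    exact: integrable_scale.
  by apply/funext => x; ring.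
rewrite (Rintegral_sum _ iF).2; apply: eq_bigr => k _.
under eq_Rintegral do rewrite mulrA.
by rewrite RintegralZr.
Qed.

Lemma feature_kernel y :
  mu.-integrable setT
    (EFin \o (fun x => h x * \int[P]_t (\sum_(k <- r) feature k x t * feature k y t))) /\
  \int[mu]_x (h x * \int[P]_t (\sum_(k <- r) feature k x t * feature k y t)) =
  feature_transform y.
Proof.
pose psi (z : 'rV[R]_n * T) := \sum_(k <- r) feature k z.1 z.2 * feature k y z.2.
have mpsi : measurable_fun setT psi.
  apply: measurable_sum => k; apply: measurable_funM; first exact: measurable_feature.
  exact: measurableT_comp (measurable_feature2 k y) measurable_snd.
have hpsi x t : `|h x * psi (x, t)| <=
    (\sum_(k <- r) K * (M * M * `|p k y|)) * `|h x|.
  apply: (@sum_feature_le (fun k => feature k y t)) => k; exact: feature_le.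
split; first exact: (integrable_Rintegral_bounded P mpsi sh.1 hpsi).
rewrite (Rintegral_Fubini_bounded P mpsi sh.1 hpsi).
under eq_Rintegral do rewrite (inner_sum (fun k => feature k y _)).
rewrite (Rintegral_sum _ _).2// => k.
apply: (@dominated_integrable_fun _ _ _ P (cst (K * N * (M * M * `|p k y|)))).
- by apply: measurable_funM => //; exact: measurable_feature2.
- exact: finite_measure_integrable_cst.
- move=> t; rewrite normrM (le_trans _ (ler_norm _))// ler_pM//; exact: feature_le.
Qed.

(* Fubini turns [\int h W] into the sum of the second moments of the feature
   coefficients of [h]. *)
Lemma feature_transform_eq0 : \int[mu]_x (h x * feature_transform x) = 0 ->
  {ae P, forall t, \sum_(k <- r) feature_coef h k t ^+ 2 = 0}.
Proof.
pose psi (z : 'rV[R]_n * T) := \sum_(k <- r) feature k z.1 z.2 * feature_coef h k z.2.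
have mpsi : measurable_fun setT psi.
  apply: measurable_sum => k; apply: measurable_funM; first exact: measurable_feature.
  exact: measurableT_comp (mcoef k) measurable_snd.
have hpsi x t : `|h x * psi (x, t)| <= (\sum_(k <- r) K * (K * N)) * `|h x|.
  by apply: (@sum_feature_le (fun k => feature_coef h k t)).
have icf k x : P.-integrable setT (EFin \o (fun t => feature k x t * feature_coef h k t)).
  apply: (@dominated_integrable_fun _ _ _ P (cst ((M * M * `|p k x|) * (K * N)))).
  - by apply: measurable_funM => //; exact: measurable_feature2.
  - exact: finite_measure_integrable_cst.
  - move=> t; rewrite normrM (le_trans _ (ler_norm _))// ler_pM//; exact: feature_le.
have -> : (fun x => h x * feature_transform x) = (fun x => h x * \int[P]_t psi (x, t)).
  apply/funext => x; congr (_ * _).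
  rewrite (Rintegral_sum r (fun k => icf k x)).2; apply: eq_bigr => k _.
  by apply: eq_Rintegral => t _; rewrite mulrC.
rewrite (Rintegral_Fubini_bounded P mpsi sh.1 hpsi).
under eq_Rintegral do rewrite (inner_sum (fun k => feature_coef h k _)).
have msum : measurable_fun setT
    (fun t => \sum_(k <- r) feature_coef h k t * feature_coef h k t).
  by apply: measurable_sum => k; exact: measurable_funM.
have isum : P.-integrable setT
    (EFin \o (fun t => \sum_(k <- r) feature_coef h k t * feature_coef h k t)).
  apply: (Rintegral_sum r _).1 => k.
  apply: (@dominated_integrable_fun _ _ _ P (cst ((K * N) * (K * N)))).
  - exact: measurable_funM.
  - exact: finite_measure_integrable_cst.
  - by move=> t; rewrite normrM (le_trans _ (ler_norm _))// ler_pM.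
move=> e; have /ae_eq_integral_abs : (\int[P]_t `|(EFin \o (fun t =>
     (\sum_(k <- r) feature_coef h k t * feature_coef h k t)%R)) t|)%E = 0%E.
  under eq_integral => t _.
    rewrite gee0_abs; first over.
    by rewrite lee_fin sumr_ge0// => k _; rewrite -expr2 sqr_ge0.
  rewrite -[LHS]fineK; last exact: integrable_fin_num.
  by congr EFin.
move=> /(_ measurableT); have mE := (measurable_EFinP _ _).2 msum.
move=> /(_ mE); apply: filterS => t /(_ Logic.I)[] {2}<-.
by apply: eq_bigr => k _; rewrite expr2.
Qed.

End random_features.

Lemma C11_weaken (R : realType) (M M' : R) (G g : R -> R) : M <= M' ->
  C11 M G g -> C11 M' G g.
Proof.
move=> MM' [GM dG gM gL]; split=> // [x|x|x y].
- exact: le_trans (GM x) MM'.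
- exact: le_trans (gM x) MM'.
- by rewrite (le_trans (gL x y))// ler_wpM2r.
Qed.

(** The Lipschitz constant of the derivative of order k + 1 is a bound on that of order k + 2. The
    orders k = 0 and 1 are needed, since both [sigma] and its derivative occur in features. *)
Lemma admissible_sigma_C11 (R : realType) (sigma : R -> R) :
  admissible_sigma sigma -> exists M,
    C11 M sigma (derive1 sigma) /\ C11 M (derive1 sigma) (derive1n 2 sigma).
Proof.
move=> [sC _].
have ds k (x : R) : (k < 4)%N ->
    is_derive x (1 : R) (derive1n k sigma) (derive1n k.+1 sigma x).
  move=> k4; have [_ /(_ k4 x) dk _] := sC k (ltnW k4).
  by split=> //; rewrite /= derive1E.
have C k : (k.+2 < 4)%N ->
    exists M, C11 M (derive1n k sigma) (derive1n k.+1 sigma).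
  move=> k4; have k3 : (k < 4)%N by rewrite (leq_trans _ k4)// ltnW.
  have [_ _ [A hA]] := sC k (ltnW k3).
  have [_ _ [B hB]] := sC k.+1 k3.
  have [_ _ [D hD]] := sC k.+2 (ltnW k4).
  exists (`|A| + `|B| + `|D|).
  have le (x y z : R) : x <= `|y| -> 0 <= z -> x <= `|y| + z.
    by move=> xy z0; rewrite ler_wpDr.
  split.
  - move=> x; rewrite (le_trans (hA x))// -addrA; apply: le; first exact: ler_norm.
    exact: addr_ge0.
  - by move=> x; exact: ds.
  - move=> x; rewrite (le_trans (hB x))// addrAC addrC; apply: le; first exact: ler_norm.
    exact: addr_ge0.
  - move=> x y; apply: (le_trans (bounded_derive_lipschitz _ hD x y)).
      by move=> z; apply: ds; exact: ltnW.
    rewrite ler_wpM2r// addrC; apply: le; first exact: ler_norm.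
    exact: addr_ge0.
have [M0 C0] := C 0%N isT; have [M1 C1] := C 1%N isT.
exists (Num.max M0 M1); split.
  by apply: C11_weaken C0; rewrite le_max lexx.
by apply: C11_weaken C1; rewrite le_max lexx orbT.
Qed.

Section square_integrable.
Context d (T : measurableType d) (R : realType).
Context (mu : {finite_measure set T -> \bar R}) (D : set T).
Hypothesis mD : measurable D.

(** On a finite measure space [|z| <= 1 + z^2] suffices. *)
Lemma inL2_integrable (v : T -> R) : inL2 mu D v ->
  mu.-integrable setT (EFin \o (fun x => v x * \1_D x)).
Proof.
move=> [mv v2]; have mvD := measurable_mul_indic mD mv.
have i2 : mu.-integrable setT (EFin \o (fun x => (v x * \1_D x) ^+ 2)).
  apply/integrableP; split.
    by apply/measurable_EFinP; exact: measurable_funX.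
  have := poweR_lty 2 v2; rewrite /L2norm poweR_Lnorm ?pnatr_eq0//.
  apply: le_lt_trans; rewrite le_eqVlt; apply/orP; left; apply/eqP.
  apply: eq_integral => x _; rewrite [in RHS]abse_EFin poweR_EFin powR_mulrn//.
  by rewrite -normrX.
have i1 : mu.-integrable setT (EFin \o cst 1) by exact: finite_measure_integrable_cst.
apply: (dominated_integrable_fun mvD (integrable_add i1 i2)) => x /=.
set z := v x * _; rewrite (le_trans _ (ler_norm _))//.
rewrite -[z ^+ 2]real_normK ?num_real//; have := normr_ge0 z; nra.
Qed.

End square_integrable.

Section full_support.
Context d (T : measurableType d) (R : realType) (P : probability T R).
Context (n : nat) (w : T -> 'rV[R]_n) (b : T -> R).
Hypothesis wb_support : forall U : set ('rV[R]_n * R), open U -> U !=set0 ->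
  (0 < P [set t | U (w t, b t)])%E.
Context (mu : {measure set 'rV[R]_n -> \bar R}) (Omega : set 'rV[R]_n).
Variables (M0 M : R) (G g : R -> R) (h : 'rV[R]_n -> R).
Hypothesis OmegaM : forall x, Omega x -> forall i, `|x 0 i| <= M0.
Hypothesis cG : C11 M G g.
Hypothesis sh : supported_integrable mu Omega h.

Let Fn (q : 'rV[R]_n * R) := \int[mu]_x (h x * G (dotv q.1 x + q.2)).

Let Fn_lipschitz : exists2 C, 0 <= C & forall q q',
  `|Fn q - Fn q'| <= C * (`|q.1 - q'.1| + `|q.2 - q'.2|).
Proof.
(* The sum controls the variation in w through the coordinates of x, the added 1 the variation in
   b. *)
pose K := \sum_(j < n) `|M0| + 1.
have ih := integrable_norm sh.1.
have K1 : 1 <= K by rewrite lerDr sumr_ge0.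
have K0 : 0 <= K by rewrite (le_trans ler01).
exists (M * (K * \int[mu]_x `|h x|)).
  rewrite mulr_ge0 ?(C11_ge0 cG)// mulr_ge0//.
  exact: Rintegral_ge0.
move=> q q'; set r := `|q.1 - q'.1| + _; have r0 : 0 <= r by rewrite addr_ge0.
have iG q0 : mu.-integrable setT (EFin \o (fun x => h x * G (dotv q0.1 x + q0.2))).
  apply: (C11_bounded_mul cG sh.1).
  by apply: measurable_funD => //; exact: measurable_dotv.
have := @Rintegral_lipschitz _ _ _ mu M G g cG G h (fun x => dotv q.1 x + q.2)
  (fun x => dotv q'.1 x + q'.2) (fun x => (r * K) * `|h x|) (C11_lipschitz cG)
  (iG q) (iG q') (integrable_scale _ ih).
rewrite RintegralZl// => le; rewrite -mulrA [X in M * X]mulrC mulrA.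
rewrite (_ : _ * r * _ = M * (r * K * \int[mu]_x `|h x|)); last by ring.
apply: le => x; have [Ox|nOx] := pselect (Omega x); last first.
  by rewrite (sh.2 _ nOx) mul0r normr0 mulr0.
rewrite normrM mulrC ler_wpM2r//.
have -> : dotv q.1 x + q.2 - (dotv q'.1 x + q'.2) =
    dotv x (q.1 - q'.1) + (q.2 - q'.2).
  rewrite !(dotvC _ x) [dotv x (_ - _)]dotvC dotvDl -[- q'.1]scaleN1r dotvZl.
  by rewrite !(dotvC _ x); ring.
rewrite (le_trans (ler_normD _ _))// mulrC /r mulrDr lerD//.
  rewrite (le_trans (norm_dotv_le _ _))// ler_wpM2r//.
  rewrite /K ler_wpDr// ler_sum// => j _.
  by rewrite (le_trans (OmegaM Ox j))// ler_norm.
by rewrite ler_peMl.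
Qed.

(** [Fn] is Lipschitz in (w, b), so a nonzero value persists on a nonempty open set, which the law
    of (w, b) charges. *)
Lemma full_support_annihilates :
  measurable_fun setT (fun t => Fn (w t, b t)) ->
  {ae P, forall t, Fn (w t, b t) = 0} -> annihilates mu h G.
Proof.
move=> mFn Fn0 w0 b0; apply: contrapT => /eqP F0.
pose U := [set q | Fn q != 0].
have oU : open U.
  have [C C0 lF] := Fn_lipschitz.
  rewrite openE => q Uq; apply/nbhs_ballP.
  have Fq : 0 < `|Fn q| by rewrite normr_gt0.
  have C1 : 0 < 2 * C + 1 by rewrite ltr_wpDl// mulr_ge0.
  (* In this ball both components move by less than the radius e, so [Fn] changes by at most 2 C e,
     less than [|Fn q|]. *)
  exists (`|Fn q| / (2 * C + 1)) => /=; first by rewrite divr_gt0.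
  move=> q' [/= bq1 bq2]; rewrite /U /=; apply/negP => /eqP Fq'.
  have := lF q q'; rewrite Fq' subr0.
  move: bq1 bq2; rewrite -!ball_normE /= => bq1 bq2.
  set e := _ / _ in bq1 bq2; have eE : `|Fn q| = e * (2 * C + 1).
    by rewrite /e divfK// gt_eqF.
  rewrite leNgt => /negP; apply.
  have e0 : 0 < e by rewrite divr_gt0.
  apply: (@le_lt_trans _ _ (C * (e + e))).
    by rewrite ler_wpM2l// lerD// ltW.
  by rewrite eE; nra.
have : (0 < P [set t | U (w t, b t)])%E by apply: wb_support => //; exists (w0, b0).
suff -> : P [set t | U (w t, b t)] = 0%E by rewrite ltxx.
have mU : measurable [set t | U (w t, b t)].
  rewrite (_ : [set t | _] = ~` ((fun t => Fn (w t, b t)) @^-1` [set 0])).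
    apply: measurableC; rewrite -[X in measurable X]setTI.
    exact: mFn.
  apply/seteqP; split=> t /=; first by move=> /eqP.
  by move=> /eqP.
have [N [mN N0 sN]] := Fn0.
apply/eqP; rewrite eq_le measure_ge0 andbT -N0 le_measure ?inE//.
by move=> t /= /eqP Ut; apply: sN.
Qed.

End full_support.

(** Lower powers are dominated by 1 + z^3, and the product of two coordinates by the sum of their
    squares. *)
Lemma admissible_moments (R : realType) d (T : measurableType d)
    (P : probability T R) (n : nat) (w : T -> 'rV[R]_n) :
  measurable_fun setT w ->
  (forall k, ('E_P[fun t => (`|w t 0 k| ^+ 3)%R] < +oo)%E) ->
  (forall i, P.-integrable setT (EFin \o (fun t => w t 0 i))) /\
  (forall i j, P.-integrable setT (EFin \o (fun t => w t 0 i * w t 0 j))).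
Proof.
move=> mw w3.
have mwi i : measurable_fun setT (fun t => w t 0 i).
  exact: measurableT_comp (measurable_coord_rV i) mw.
have i3 i : P.-integrable setT (EFin \o (fun t => `|w t 0 i| ^+ 3)).
  apply/integrableP; split.
    by apply/measurable_EFinP; apply: measurable_funX; exact: measurableT_comp.
  have := w3 i; rewrite expectation.unlock; apply: le_lt_trans.
  rewrite le_eqVlt; apply/orP; left; apply/eqP; apply: eq_integral => t _.
  by rewrite /= ger0_norm// exprn_ge0.
have i1 : P.-integrable setT (EFin \o cst 1) by exact: finite_measure_integrable_cst.
have cube (k : nat) (z : R) : (k <= 3)%N -> 0 <= z -> z ^+ k <= 1 + z ^+ 3.
  move=> k3 z0; have [z1|/ltW z1] := leP z 1.
    by rewrite ler_wpDr ?exprn_ge0// exprn_ile1.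
  by rewrite ler_wpDl// ler_weXn2l.
split=> [i|i j].
  apply: (dominated_integrable_fun (mwi i) (integrable_add i1 (i3 i))) => t /=.
  by rewrite (le_trans _ (ler_norm _))//; exact: (cube 1%N _ isT (normr_ge0 (w t 0 i))).
apply: (dominated_integrable_fun (measurable_funM (mwi i) (mwi j))
  (integrable_add (integrable_add i1 (i3 i)) (integrable_add i1 (i3 j)))) => t /=.
rewrite (le_trans _ (ler_norm _))// normrM.
have := cube 2%N _ isT (normr_ge0 (w t 0 i)); have := cube 2%N _ isT (normr_ge0 (w t 0 j)).
have := normr_ge0 (w t 0 i); have := normr_ge0 (w t 0 j).
set y := `|_|; set z := `|_|; nra.
Qed.

(** * The operator B *)

Section kernel_operator.
Context (R : realType) (n : nat) (Omega : set 'rV[R]_n).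
Context (mu : {finite_measure set 'rV[R]_n -> \bar R}).
Variables (eta : 'rV[R]_n -> R) (sigma : R -> R).
Context (d : measure_display) (T : measurableType d) (P : probability T R).
Context (c b : {RV P >-> R}) (w : {RV P >-> 'rV[R]_n}) (K0 : R).
Hypotheses (oO : open Omega) (bO : bounded_set Omega).
Hypothesis aeta : admissible_eta Omega eta.
Hypothesis asigma : admissible_sigma sigma.
Hypothesis aparam : admissible_parameters c b w K0.
Implicit Types (x y : 'rV[R]_n) (v : 'rV[R]_n -> R) (t : T).

Let mO : measurable Omega := open_measurable_rV oO.
Let mc : measurable_fun setT (c : T -> R) := measurable_funPT c.
Let mb : measurable_fun setT (b : T -> R) := measurable_funPT b.
Let mw : measurable_fun setT (w : T -> 'rV[R]_n) := measurable_funPT w.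

(* [c] is only bounded almost surely. *)
Let c' t := c t * \1_[set t | `|c t| < K0] t.

Let mc' : measurable_fun setT c'.
Proof.
apply: measurable_funM => //; apply: measurable_indic.
rewrite (_ : [set t | _] = (fun t => `|c t|) @^-1` `]-oo, K0[).
  rewrite -[X in measurable X]setTI.
  have : measurable_fun setT (fun t => `|c t|) by exact: measurableT_comp.
  exact.
by apply/seteqP; split=> t; rewrite /= in_itv.
Qed.

Let c'_le t : `|c' t| <= `|K0|.
Proof.
rewrite /c' indicE; have [/set_mem /= ct|_] := boolP (t \in _).
  by rewrite mulr1 (le_trans (ltW ct))// ler_norm.
by rewrite mulr0 normr0.
Qed.

Let c'E : {ae P, forall t, c' t = c t}.
Proof.
have [_ [cK _] _ _ _] := aparam; apply: filterS cK => t ct.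
by rewrite /c' indicE mem_set// mulr1.
Qed.

(** [None] indexes the feature with [sigma]. The factor x.y + 1 of the other term splits into a
    constant, indexed by [Some None], and one product of coordinates for each [Some (Some j)]. *)
Let I : Type := option (option 'I_n).
Let r : seq I := None :: Some None :: [seq Some (Some j) | j <- enum 'I_n].
Let a (k : I) : T -> R := if k is Some _ then c' else cst 1.
Let tau (k : I) : R -> R := if k is Some _ then derive1 sigma else sigma.
Let tau' (k : I) : R -> R :=
  if k is Some _ then derive1n 2 sigma else derive1 sigma.
Let p (k : I) : 'rV[R]_n -> R :=
  if k is Some (Some j) then fun x => x 0 j else cst 1.

Let ma k : measurable_fun setT (a k). Proof. by case: k. Qed.

Let pC k : Ck setT 1 (p k).
Proof.
case: k => [[j|]|]; [|exact: Ck1_cst|exact: Ck1_cst].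
have dj i x : is_derive x (delta_mx 0 i : 'rV[R]_n) (fun x : 'rV[R]_n => x 0 j) ((i == j)%:R).
  apply: (@is_derive_line _ _ _ (fun h => h * (i == j)%:R + x 0 j)).
    by move=> h; rewrite !mxE eqxx /= [j == i]eq_sym.
  rewrite -[X in is_derive _ _ _ X]addr0; apply: is_deriveD.
  rewrite (_ : (fun h => _) = (i == j)%:R \*: id).
    by rewrite -[X in is_derive _ _ _ X]mulr1; apply: is_deriveZ.
  by apply/funext => h; rewrite mulrC.
apply/Ck1P; split; first exact: coord_continuous.
- by move=> i x; case: (dj i x).
- move=> i; rewrite (_ : partial i _ = cst (i == j)%:R); first exact: cst_continuous.
  by apply/funext => x; case: (dj i x).
Qed.

Let bounds : exists M M0, [/\ forall x, Omega x -> forall i, `|x 0 i| <= M0,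
  forall k t, `|a k t| <= M, forall k, C11 M (tau k) (tau' k) &
  forall k x, Omega x -> `|p k x| <= M].
Proof.
have [Ms [C0 C1]] := admissible_sigma_C11 asigma.
have [M0 OM] := bounded_set_coord bO.
have Ms0 := C11_ge0 C0.
exists (1 + `|K0| + Ms + `|M0|), M0; split=> //.
- case=> [k|] t /=; first by rewrite (le_trans (c'_le t))//; have := normr_ge0 M0; lra.
  by rewrite normr1; have := normr_ge0 M0; have := normr_ge0 K0; lra.
- by case=> [k|] /=; [move: C1|move: C0]; apply: C11_weaken;
    have := normr_ge0 M0; have := normr_ge0 K0; lra.
- case=> [[j|]|] x Ox /=; have := normr_ge0 M0; have := normr_ge0 K0.
  + by have := OM x Ox j; have := ler_norm M0; lra.
  + by rewrite normr1; lra.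
  + by rewrite normr1; lra.
Qed.

Let ft := feature w b a tau p.

Let kerAE x y :
  kerA c b w sigma x y = \int[P]_t (\sum_(k <- r) ft k x t * ft k y t).
Proof.
have [M [M0 [_ _ ctau _]]] := bounds.
have mu' z : measurable_fun setT (fun t => dotv (w t) z + b t).
  by apply: measurable_funD => //; exact: measurable_dotv.
have ms z : measurable_fun setT (fun t => sigma (dotv (w t) z + b t)).
  exact: measurableT_comp (C11_measurable (ctau None)) (mu' z).
have mds z : measurable_fun setT (fun t => derive1 sigma (dotv (w t) z + b t)).
  exact: measurableT_comp (C11_measurable (ctau (Some None))) (mu' z).
rewrite /kerA expectation.unlock /Rintegral; congr fine.
apply: ae_eq_integral => //.
- apply/measurable_EFinP; apply: measurable_funD; first exact: measurable_funM.
  apply: measurable_funM => //; apply: measurable_funM => //.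
  by apply: measurable_funM => //; exact: measurable_funX.
- apply/measurable_EFinP; apply: measurable_sum => k.
  by apply: measurable_funM; apply: measurable_feature2.
apply: filterS c'E => t ct _; congr EFin.
rewrite /r !big_cons big_map big_enum /= /ft /feature /= ct.
under [in RHS]eq_bigr do rewrite mulrACA.
rewrite -mulr_sumr -/(dotv x y); ring.
Qed.

Let eta_C1 : Ck setT 1 eta.
Proof.
have [[eC _] _ _ _] := aeta; move=> s s1.
have [A B] := eC s (leq_trans s1 (isT : (1 <= 3)%N)); split=> // s0.
by apply: B; exact: leq_trans s0 _.
Qed.

(** The factor [eta x] of the kernel is absorbed into the integrated function, while [eta y] stays
    in front of the transform and gives the boundary values. *)
Let hh v x := v x * \1_Omega x * eta x.

Let shh v : inL2 mu Omega v -> supported_integrable mu Omega (hh v).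
Proof.
move=> L2v; have [[_ /(_ [::] isT)[E etaE]] _ _ _] := aeta.
apply: (@supported_bounded_mul _ _ _ _ E).
- by apply: continuous_measurable_rV; have /Ck1P[] := eta_C1.
- by move=> x _; exact: etaE.
split; first exact: inL2_integrable.
by move=> x nOx; rewrite indicE memNset// mulr0.
Qed.

Let W v := feature_transform P w b mu r a tau p (hh v).

Let moments := @admissible_moments _ _ _ P n w mw (let: And5 _ _ _ H _ := aparam in H).

Let opBE v : inL2 mu Omega v ->
  opB c b w sigma eta Omega mu v = (fun y => eta y * W v y).
Proof.
move=> L2v; apply/funext => y; have [M [M0 [OM aM ctau pM]]] := bounds.
have [iW WE] := feature_kernel P mw mb r ma aM ctau pC pM (shh L2v) y.
rewrite /W -WE -RintegralZl// /opB Rintegral_mkcond.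
apply: eq_Rintegral => x _; rewrite -kerAE /kerB /hh /patch indicE.
by case: (x \in Omega); rewrite ?mulr1 ?mulr0 ?mul0r ?mulr0//; ring.
Qed.

Let W_C1 v : inL2 mu Omega v -> Ck setT 1 (W v).
Proof.
move=> L2v; have [M [M0 [OM aM ctau pM]]] := bounds.
exact: (feature_transform_Ck1 mw mb moments.1 moments.2 r ma aM ctau pC pM (shh L2v)).
Qed.

Lemma opB_vanishing v : inL2 mu Omega v ->
  vanishing Omega (opB c b w sigma eta Omega mu v).
Proof.
move=> L2v; rewrite opBE//; split; first by apply: Ck1M => //; exact: W_C1.
by have [_ _ e0 _] := aeta; move=> x /e0 ->; rewrite mul0r.
Qed.

Lemma opB_injective v : inL2 mu Omega v ->
  ae_eq mu Omega (opB c b w sigma eta Omega mu v) (cst 0) ->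
  ae_eq mu Omega v (cst 0).
Proof.
move=> L2v Bv0; have [M [M0 [OM aM ctau pM]]] := bounds.
have sh := shh L2v.
(* Regrouping [eta] with [W v] makes this integral the pairing of v with B v. *)
have hW0 : \int[mu]_x (hh v x * W v x) = 0.
  rewrite /Rintegral (ae_eq_integral (cst 0%E)) ?integral0//.
    apply/measurable_EFinP; apply: measurable_funM; first exact: integrable_measurable sh.1.
    by apply: continuous_measurable_rV; have /Ck1P[] := W_C1 L2v.
  apply: filterS Bv0 => x + _; rewrite opBE// /hh => Bv /=; congr EFin.
  rewrite -mulrA indicE; have [/set_mem/Bv ->|_] := boolP (x \in Omega).
    by rewrite mulr0.
  by rewrite mulr0 mul0r.
have S0 := feature_transform_eq0 mw mb ma aM ctau pC pM sh hW0.
have coefE t : feature_coef w b mu a tau p (hh v) None t =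
    \int[mu]_x (hh v x * sigma (dotv (w t) x + b t)).
  by apply: eq_Rintegral => x _; rewrite /feature /= mul1r mulr1.
have ann : annihilates mu (hh v) sigma.
  have [_ _ supp _ _] := aparam.
  apply: (full_support_annihilates supp OM (ctau None) sh).
    rewrite (_ : (fun t => _) = feature_coef w b mu a tau p (hh v) None).
      exact: (measurable_feature_coef P mw mb ma aM ctau pC pM sh None).
    by apply/funext => t; rewrite coefE.
  (* A sum of squares vanishes, so its first term does: only the coefficient of the [sigma] feature
     is kept. *)
  apply: filterS S0 => t /eqP; rewrite /r big_cons.
  rewrite paddr_eq0 ?sqr_ge0 ?sumr_ge0//; last by move=> k _; rewrite sqr_ge0.
  by rewrite sqrf_eq0 => /andP[/eqP + _]; rewrite coefE.
have [_ ncs] := asigma.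
have := discriminatory OM (ctau None) ncs sh ann.
apply: filterS => x /(_ Logic.I) /= hx Ox.
have [_ /(_ x Ox)/andP[eta0 _] _ _] := aeta.
move: hx => /eqP; rewrite /hh indicE mem_set// mulr1 mulf_eq0 (gt_eqF eta0) orbF.
by move=> /eqP.
Qed.

End kernel_operator.

Theorem theorem45 (R : realType) (n : nat)
  (Omega : set 'rV[R]_n) (kappa : R)
  (mu : {measure set 'rV[R]_n -> \bar R})
  (eta : 'rV[R]_n -> R)
  (L : ('rV[R]_n -> R) -> 'rV[R]_n -> R)
  (f g : 'rV[R]_n -> R)
  (sigma : R -> R)
  (d : measure_display) (T : measurableType d) (P : probability T R)
  (c b : {RV P >-> R}) (w : {RV P >-> 'rV[R]_n}) (K0 : R)
  (alpha : R) (Q : R -> 'rV[R]_n -> R) (Qinf : 'rV[R]_n -> R) :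
  (0 < n)%N ->
  open Omega -> bounded_set Omega ->
  0 < kappa < 1 -> holder_boundary Omega 3 kappa ->
  continuous_density Omega mu ->
  admissible_eta Omega eta ->
  lipschitz_operator Omega mu L ->
  sobolev Omega mu 2 f -> has_trace Omega mu f g ->
  admissible_sigma sigma ->
  admissible_parameters c b w K0 ->
  0 < alpha ->
  wide_network_limit Omega mu (opB c b w sigma eta Omega mu) L alpha f Q ->
  sobnorm Omega mu 1 (fun x => Q t x - Qinf x) @[t --> +oo] --> 0%E ->
  sobolev Omega mu 2 Qinf ->
  ae_eq mu Omega (opB c b w sigma eta Omega mu (L Qinf)) (cst 0) ->
  strong_solution Omega mu L g Qinf.
Proof.
move=> _ oO bO _ _ dmu aeta lipL sf fg asigma aparam _ Qlim Qinfty sQ Bfix.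
(* From here on [mu] carries the structure of a finite measure, which the Fubini argument and the
   integrability of L^2 functions require. *)
have [nu E] := finite_measure_pack (density_finite oO bO dmu); subst mu.
have [_ _ L2L _] := lipL.
split=> //.
- apply: (opB_injective oO bO aeta asigma aparam) => //; exact: L2L.
- apply: (wide_network_limit_trace oO dmu _ sf fg Qlim Qinfty) => u su.
  by apply: (opB_vanishing oO bO aeta asigma aparam); exact: L2L.
Qed.
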